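(* Let $\gamma\ge0$, $1\le r<\frac N2$, $(r,\gamma)\ne(1,0)$, and let $f,g\in L^r(\Omega)\setminus\{0\}$ be non-negative. Let $u$ and $v$ be the weak solutions obtained by approximation (see context) of $$-\Delta w+(-\Delta)^s w=\frac{h(x)}{w^\gamma},\quad w>0\ \text{ in }\Omega,\qquad w=0\ \text{ in }\mathbb{R}^N\setminus\Omega,$$ with datum $h=f$ and $h=g$, respectively. If $f\le g$, then $u\le v$ a.e. in $\Omega$.
   Context: $\Omega\subset\mathbb{R}^N$ ($N\ge2$) is a bounded domain with $C^{1,1}$ boundary and $s\in(0,1)$ is fixed. $C(N,s)=\left(\int_{\mathbb{R}^N}\frac{1-\cos(\xi_1)}{|\xi|^{N+2s}}\,d\xi\right)^{-1}$ and $(-\Delta)^su(x)=C(N,s)\,\mathrm{P.V.}\int_{\mathbb{R}^N}\frac{u(x)-u(y)}{|x-y|^{N+2s}}\,dy$. Functions on $\Omega$ are extended by zero outside $\Omega$. Solution obtained by approximation for a datum $h$: let $h_n=\min\{h,n\}$ and let $w_n\in H_0^1(\Omega)$, $w_n>0$, be the unique non-negative weak solution of $-\Delta w_n+(-\Delta)^sw_n=\frac{h_n}{(w_n+1/n)^\gamma}$ in $\Omega$, $w_n=0$ in $\mathbb{R}^N\setminus\Omega$, i.e. $$\int_\Omega\nabla w_n\cdot\nabla\psi\,dx+\frac{C(N,s)}{2}\iint_{\mathbb{R}^{2N}}\frac{(w_n(x)-w_n(y))(\psi(x)-\psi(y))}{|x-y|^{N+2s}}\,dx\,dy=\int_\Omega\frac{h_n\psi}{(w_n+\frac1n)^\gamma}\,dx\quad\forall\psi\in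 H_0^1(\Omega).$$ The sequence $w_n$ is increasing in $n$, and the solution obtained by approximation is $w=\lim_{n\to\infty}w_n$ (a.e. limit). *)

(* Defs.v *)
From HB Require Import structures.
From mathcomp Require Import all_boot all_order all_algebra.
From mathcomp Require Import all_classical all_reals all_analysis.
Import Order.TTheory GRing.Theory Num.Theory.
Import numFieldNormedType.Exports.

Set Implicit Arguments.
Unset Strict Implicit.
Unset Printing Implicit Defensive.

Local Open Scope classical_set_scope.
Local Open Scope ring_scope.

(* The product sigma-algebra on row vectors; on 'rV[R]_n it is the Borel one. *)
Section measurable_rV.
Context {d} {T : sigmaRingType d}.
Variable n : nat.

Let coors : 'I_n -> 'rV[T]_n -> T := fun i x => x ord0 i.

Let rV_set0 : g_sigma_preimage coors set0.
Proof. exact: sigma_algebra0. Qed.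

Let rV_setC A : g_sigma_preimage coors A -> g_sigma_preimage coors (~` A).
Proof. exact: sigma_algebraC. Qed.

Let rV_bigcup (F : _^nat) : (forall i, g_sigma_preimage coors (F i)) ->
  g_sigma_preimage coors (\bigcup_i (F i)).
Proof. exact: sigma_algebra_bigcup. Qed.

HB.instance Definition _ := @isMeasurable.Build (measure_tuple_display d)
  'rV[T]_n (g_sigma_preimage coors) rV_set0 rV_setC rV_bigcup.

End measurable_rV.

Lemma measurable_coord d (T : sigmaRingType d) n (i : 'I_n) :
  measurable_fun [set: 'rV[T]_n] (fun x : 'rV[T]_n => x ord0 i).
Proof.
move=> _ Y mY; rewrite setTI; apply: sub_sigma_algebra => /=.
rewrite -bigcup_seq/=; exists i => /=; first by rewrite mem_index_enum.
by exists Y => //; rewrite setTI.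
Qed.

Lemma measurable_fun_rV d1 d2 (T1 : measurableType d1) (T2 : measurableType d2)
    n (f : T1 -> 'rV[T2]_n) :
  (forall i, measurable_fun [set: T1] (fun x => f x ord0 i)) ->
  measurable_fun [set: T1] f.
Proof.
move=> mf _; apply: (@measurability _ _ _ _ setT f
  (\big[setU/set0]_(i < n) preimage_set_system setT
    (fun x : 'rV[T2]_n => x ord0 i) measurable)) => //.
move=> _ [C + <-]; rewrite -bigcup_seq => -[i _ [A mA <-]].
by rewrite setTI; apply: mf.
Qed.

Section lebesgue_rV.
Context {R : realType}.

Definition cons_rV n (p : R * 'rV[R]_n) : 'rV[R]_n.+1 :=
  \row_i (if unlift ord0 i is Some j then p.2 ord0 j else p.1).

Definition uncons_rV n (x : 'rV[R]_n.+1) : R * 'rV[R]_n :=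
  (x ord0 ord0, \row_j x ord0 (lift ord0 j)).

Lemma cons_rVK n : cancel (@cons_rV n) (@uncons_rV n).
Proof.
move=> [a x]; rewrite /uncons_rV mxE unlift_none; congr pair.
by apply/rowP => j; rewrite !mxE liftK.
Qed.

Lemma measurable_cons_rV n : measurable_fun setT (@cons_rV n).
Proof.
apply: measurable_fun_rV => i; rewrite /cons_rV.
under eq_fun do rewrite mxE.
case: unliftP => [j _|_]; last exact: measurable_fst.
exact: (measurableT_comp (measurable_coord j) measurable_snd).
Qed.

Lemma measurable_uncons_rV n : measurable_fun setT (@uncons_rV n).
Proof.
apply/measurable_fun_pairP; split; first exact: measurable_coord.
apply: measurable_fun_rV => i; rewrite /comp/=.
by under eq_fun do rewrite mxE; exact: measurable_coord.
Qed.

Section lebesgue_succ.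
Variables (n : nat) (mu : {sigma_finite_measure set 'rV[R]_n -> \bar R}).

Definition lebesgue_succ : set 'rV[R]_n.+1 -> \bar R :=
  pushforward (lebesgue_measure \x mu)%E (@cons_rV n).

Let lebesgue_succ0 : lebesgue_succ set0 = 0%E.
Proof. by rewrite /lebesgue_succ /pushforward preimage_set0 measure0. Qed.

Let lebesgue_succ_ge0 A : (0 <= lebesgue_succ A)%E.
Proof. by rewrite /lebesgue_succ /pushforward measure_ge0. Qed.

Let lebesgue_succ_semi_sigma_additive : semi_sigma_additive lebesgue_succ.
Proof.
have mc := @measurable_cons_rV n.
exact: (@measure_semi_sigma_additive _ _ _
  (measure_function_pushforward__canonical__measure_function_Measure
    (lebesgue_measure \x mu)%E mc)).
Qed.

HB.instance Definition _ := isMeasure.Build _ _ _ lebesgue_succ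
  lebesgue_succ0 lebesgue_succ_ge0 lebesgue_succ_semi_sigma_additive.

Let lebesgue_succ_sigma_finite : sigma_finite setT lebesgue_succ.
Proof.
have /sigma_finiteP[F [FT ndF Foo]] := sigma_finiteT (@lebesgue_measure R).
have /sigma_finiteP[G [GT ndG Goo]] := sigma_finiteT mu.
exists (fun k => @uncons_rV n @^-1` (F k `*` G k)).
  apply/seteqP; split=> // x _.
  have [i _ Fi] : (\bigcup_k F k) (uncons_rV x).1 by rewrite -FT.
  have [j _ Gj] : (\bigcup_k G k) (uncons_rV x).2 by rewrite -GT.
  exists (maxn i j) => //; split.
  - by move: Fi; exact/subsetPset/ndF/leq_maxl.
  - by move: Gj; exact/subsetPset/ndG/leq_maxr.
move=> k; have [mF Fk] := Foo k; have [mG Gk] := Goo k; split.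
  rewrite -[X in measurable X]setTI; apply: measurable_uncons_rV => //.
  exact: measurableX.
rewrite /lebesgue_succ /pushforward -comp_preimage.
rewrite (_ : _ \o _ = id); last by apply/funext => p; exact: cons_rVK.
rewrite preimage_id product_measure1E//.
by rewrite lte_mul_pinfty// ge0_fin_numE.
Qed.

HB.instance Definition _ := Measure_isSigmaFinite.Build _ _ _ lebesgue_succ
  lebesgue_succ_sigma_finite.

End lebesgue_succ.

(* n-dimensional Lebesgue measure on R^n = R x R^(n-1), the factors being glued
   by cons_rV; \d_0 is the unit mass on the one-point space R^0. *)
Fixpoint lebesgue_rV (n : nat) : {sigma_finite_measure set 'rV[R]_n -> \bar R} :=
  if n is k.+1 then [the {sigma_finite_measure set 'rV[R]_k.+1 -> \bar R} of
                      lebesgue_succ (lebesgue_rV k)]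
  else [the {sigma_finite_measure set 'rV[R]_0 -> \bar R} of \d_(0 : 'rV[R]_0)].

End lebesgue_rV.

Section euclidean.
Context {R : realType}.

(* The library norm `|x| on 'rV[R]_n is the sup norm. *)
Definition dotp n (x y : 'rV[R]_n) : R := \sum_i x ord0 i * y ord0 i.
Definition enorm n (x : 'rV[R]_n) : R := Num.sqrt (dotp x x).

Definition partial n (i : 'I_n) (f : 'rV[R]_n -> R) : 'rV[R]_n -> R :=
  fun x => 'D_(delta_mx ord0 i) f x.

End euclidean.

Section domains.
Context {R : realType}.

Definition C11 n (h : 'rV[R]_n -> R) :=
  (forall x, differentiable h x) /\
  exists L : R, forall (i : 'I_n) x y,
    `|partial i h x - partial i h y| <= L * `|x - y|.

(* Near each boundary point, after an orthogonal change of coordinates Q,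
   Omega is the strict epigraph, in the direction of the i-th new coordinate,
   of a C^{1,1} function of the remaining N - 1 coordinates. *)
Definition C11_boundary N (Omega : set 'rV[R]_N) :=
  forall x0, (closure Omega `\` interior Omega) x0 ->
  exists (Q : 'M[R]_N) (i : 'I_N) (h : 'rV[R]_N.-1 -> R),
    [/\ Q *m Q^T = 1%:M, C11 h &
        \forall x \near x0,
          Omega x <-> h (col' i (x *m Q)) < (x *m Q) ord0 i].

Definition bounded_C11_domain N (Omega : set 'rV[R]_N) :=
  [/\ Omega !=set0, open Omega, connected Omega, bounded_set Omega &
      C11_boundary Omega].

End domains.

Section sobolev.
Context {R : realType} {N : nat}.
Implicit Types (Omega : set 'rV[R]_N) (u f phi : 'rV[R]_N -> R)
  (G : 'rV[R]_N -> 'rV[R]_N).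

Notation leb := (@lebesgue_rV R N).

Definition smooth f :=
  forall (s : seq 'I_N) x, differentiable (foldr (@partial R N) f s) x.

(* phi \in C_c^\infty(Omega), extended by zero *)
Definition test_function Omega phi :=
  [/\ smooth phi, compact (closure [set x | phi x != 0]) &
      closure [set x | phi x != 0] `<=` Omega].

(* L^p(Omega), its elements being extended by zero outside Omega *)
Definition Lebesgue_space Omega (p : R) f :=
  f \in Lfun leb p%:E /\ forall x, ~ Omega x -> f x = 0.

Definition weak_gradient Omega u G :=
  forall phi, test_function Omega phi -> forall i : 'I_N,
    \int[leb]_(x in Omega) (u x * partial i phi x) =
    - \int[leb]_(x in Omega) (G x ord0 i * phi x).

(* u \in H^1(Omega) with weak gradient G; G is determined by u up to a
   negligible set *)
Definition H1 Omega u G :=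
  [/\ Lebesgue_space Omega 2 u,
      forall i : 'I_N, Lebesgue_space Omega 2 (fun x => G x ord0 i) &
      weak_gradient Omega u G].

(* H^1_0(Omega) = closure of C_c^\infty(Omega) in H^1(Omega) *)
Definition H10 Omega u G :=
  H1 Omega u G /\
  exists phi : nat -> 'rV[R]_N -> R,
    [/\ forall k, test_function Omega (phi k),
        Lnorm leb 2%:E (fun x => (phi k x - u x)%:E) @[k --> \oo] --> 0%E &
        forall i : 'I_N,
          Lnorm leb 2%:E (fun x => (partial i (phi k) x - G x ord0 i)%:E)
            @[k --> \oo] --> 0%E].

End sobolev.

Section mixed_problem.
Context {R : realType} {N : nat}.
Implicit Types (Omega : set 'rV[R]_N) (h w : 'rV[R]_N -> R) (s gamma : R).

Notation leb := (@lebesgue_rV R N).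

(* xi_1, with junk value 0 in dimension 0 *)
Definition coord1 (xi : 'rV[R]_N) : R := oapp (xi ord0) 0 (insub 0%N).

Definition frac_const s : R :=
  (\int[leb]_xi ((1 - cos (coord1 xi)) / enorm xi `^ (N%:R + 2 * s)))^-1.

(* An equation between extended reals: the first and the last integral being
   finite, it forces the double integral to converge absolutely. *)
Definition regularized_weak_form Omega s gamma h (n : nat) w
    (Gw : 'rV[R]_N -> 'rV[R]_N) :=
  forall psi Gpsi, H10 Omega psi Gpsi ->
  (\int[leb]_(x in Omega) (dotp (Gw x) (Gpsi x))%:E +
   (frac_const s / 2)%:E *
   \int[leb \x leb]_z
     ((w z.1 - w z.2) * (psi z.1 - psi z.2) /
        enorm (z.1 - z.2) `^ (N%:R + 2 * s))%:E =
   \int[leb]_(x in Omega)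
     (Num.min (h x) n%:R * psi x / (w x + n%:R^-1) `^ gamma)%:E)%E.

Definition regularized_solution Omega s gamma h (n : nat) w :=
  {ae leb, forall x, Omega x -> 0 < w x} /\
  exists2 Gw, H10 Omega w Gw & regularized_weak_form Omega s gamma h n w Gw.

Definition approximation_solution Omega s gamma h w :=
  exists w_ : nat -> 'rV[R]_N -> R,
    (forall n, (0 < n)%N -> regularized_solution Omega s gamma h n (w_ n)) /\
    {ae leb, forall x, w_ n x @[n --> \oo] --> w x}.

End mixed_problem.

(* Main.v *)
Require Import Defs.
From mathcomp Require Import all_boot all_order all_algebra.
From mathcomp Require Import all_classical all_reals all_analysis.
From mathcomp Require Import measurable_realfun.
From mathcomp Require Import ring lra.
Import Order.TTheory GRing.Theory Num.Theory.
Import numFieldNormedType.Exports.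
Local Open Scope classical_set_scope.
Local Open Scope ring_scope.

(** The comparison is proved for the regularized problems at each level n, and the
    almost everywhere limit n -> oo preserves it.

    At level n, let u and v be the solutions with data f <= g.  Formally, test both
    equations with the positive part of w = u - v and subtract.  The nonlocal part
    of the difference is nonnegative, because
    (w x - w y) (P (w x) - P (w y)) >= 0 for every nondecreasing P; the local part
    is the integral of |grad w| ^ 2 over the set where w > 0; the right-hand side is
    nonpositive, because min (h, n) / (w + 1 / n) ^ gamma is nondecreasing in h and
    nonincreasing in w.  Hence the positive part of w has zero gradient and vanishes.

    The space H10 is a closure of smooth compactly supported functions, and the
    positive part is not smooth.  It is replaced by the softplus
    P (t) = e (ln (1 + exp (t / e)) - ln 2), which is smooth, vanishes at 0, has
    slopes in [0, 1], and is within e of the positive part.  If test functions phi_k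
    approximate w, the P \o phi_k are test functions that approximate P \o w with
    gradient P' (w) grad w; thus P \o w is an admissible test function
    ([H10_softplus]).  The monotonicity of P gives the sign of the nonlocal part by
    a pointwise comparison of the two integrands, so that no estimate of fractional
    seminorms is involved, and the right-hand side is at most of order e
    ([energy_estimate]).

    The conclusion on w itself uses integration by parts against a coordinate
    function: the integral of psi in H10 is minus the integral of x_i times the i-th
    component of its gradient ([H10_integralE]).  For psi = P \o w this is of order
    sqrt e, and letting e tend to 0 shows that the positive part of w has integral 0
    ([regularized_comparison]).

    All this rests on the vanishing of the integral of a partial derivative of a
    compactly supported function ([integral_partial_eq0]), proved by Fubini's
    theorem and induction on the dimension. *)

Set Implicit Arguments.
Unset Strict Implicit.
Unset Printing Implicit Defensive.

(** * Borel sets and Lebesgue measure on row vectors *)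

Section borel_rV.
Context {R : realType} {n : nat}.
Implicit Types (U : set 'rV[R]_n) (x : 'rV[R]_n).

Let rbox (p : 'rV[rat]_n * nat) : set 'rV[R]_n :=
  [set x | forall i, `|x ord0 i - ratr (p.1 ord0 i)| < p.2.+1%:R^-1].

Let measurable_rbox p : measurable (rbox p).
Proof.
rewrite (_ : rbox p = \bigcap_(i in [set: 'I_n])
   ((fun x : 'rV[R]_n => x ord0 i) @^-1`
      (ball (ratr (p.1 ord0 i) : R) p.2.+1%:R^-1))).
  apply: fin_bigcap_measurable => // i _.
  by rewrite -[X in measurable X]setTI; apply: measurable_coord => //;
    apply: open_measurable; apply: ball_open; rewrite invr_gt0.
apply/seteqP; split=> x /=.
  by move=> H i _ /=; rewrite /ball/= distrC; exact: H.
by move=> H i; have := H i Logic.I; rewrite /= /ball/= distrC.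
Qed.

(** Every open set is a countable union of boxes with rational centres and radii
    1 / k, and boxes are finite intersections of coordinate slabs. *)
Lemma open_measurable_rV U : open U -> measurable U.
Proof.
move=> oU.
rewrite (_ : U = \bigcup_(p in [set p | rbox p `<=` U]) rbox p); last first.
  apply/seteqP; split=> [x Ux|x [p /= pU px]]; last exact: pU.
  have := oU; rewrite openE => /(_ _ Ux); rewrite /interior -nbhs_ballE.
  move=> [e /= e0 xeU].
  have [k ke] : exists k : nat, k.+1%:R^-1 < e / 2 :> R.
    have e20 : 0 < e / 2 by rewrite divr_gt0.
    exists (Num.truncn (e / 2)^-1).
    rewrite invf_plt ?posrE// ?ltr0Sn//.
    exact: truncnS_gt.
  have /choice[q Hq] : forall i : 'I_n, exists q : rat,
      `|x ord0 i - ratr q| < k.+1%:R^-1.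
    move=> i.
    have : x ord0 i - k.+1%:R^-1 < x ord0 i + k.+1%:R^-1.
      by rewrite ltrD2l gtrN// invr_gt0 ltr0Sn.
    move=> /rat_in_itvoo[q]; rewrite in_itv/= => /andP[q1 q2].
    by exists q; rewrite ltr_distl ltrBlDr q2 -ltrBlDr q1.
  exists (\row_i q i, k); last by move=> i /=; rewrite mxE.
  move=> y /= Hy; apply: xeU; split => // i j; rewrite (ord1 i).
  rewrite /ball/=; have := Hy j; rewrite mxE => Hyj.
  rewrite [e]splitr (le_lt_trans (ler_distD (ratr (q j)) _ _))//.
  by rewrite ltrD//; [exact: lt_trans ke|rewrite distrC; exact: lt_trans ke].
rewrite bigcup_mkcond; apply: countable_bigcupT_measurable => [|p].
  exact: countableP.
by case: ifP => // _; exact: measurable0.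
Qed.

Lemma continuous_measurable_rV (f : 'rV[R]_n -> R) :
  continuous f -> measurable_fun [set: 'rV[R]_n] f.
Proof.
move=> cf; apply: (measurability _ (RGenOpens.measurableE R)).
move=> _ [_ [a [b ->] <-]]; rewrite setTI; apply: open_measurable_rV.
by move/continuousP : cf; apply; exact: interval_open.
Qed.

End borel_rV.

Section lebesgue_rV_theory.
Context {R : realType}.

(** Peels off the first coordinate, which makes Fubini's theorem available for
    arguments by induction on the dimension. *)
Lemma integral_lebesgue_rVS n (F : 'rV[R]_n.+1 -> \bar R) :
  (@lebesgue_rV R n.+1).-integrable setT F ->
  (@lebesgue_measure R \x @lebesgue_rV R n)%E.-integrable setT
     (F \o @cons_rV R n) /\
  (\int[lebesgue_rV n.+1]_x F x =
   \int[lebesgue_measure \x lebesgue_rV n]_z (F \o @cons_rV R n) z)%E.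
Proof.
move=> iF; have mF := measurable_int _ iF.
have iFc : (@lebesgue_measure R \x @lebesgue_rV R n)%E.-integrable setT
     (F \o @cons_rV R n).
  apply/integrableP; split.
    by apply: measurableT_comp => //; exact: measurable_cons_rV.
  move/integrableP : iF => [_]; apply: le_lt_trans.
  rewrite /= /lebesgue_succ ge0_integral_pushforward//=.
  - exact: measurable_cons_rV.
  - exact: measurableT_comp.
split => //.
by rewrite /= /lebesgue_succ integral_pushforward//; exact: measurable_cons_rV.
Qed.

Lemma measurable_box n (M : R) :
  measurable [set x : 'rV[R]_n | forall i, `|x ord0 i| <= M].
Proof.
rewrite (_ : [set x | _] = \bigcap_(i in [set: 'I_n])
   ((fun x : 'rV[R]_n => x ord0 i) @^-1` `[- M, M]%classic)).
  apply: fin_bigcap_measurable => // i _.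
  by rewrite -[X in measurable X]setTI; exact: measurable_coord.
apply/seteqP; split=> x /= H i => [_|]; first by rewrite /= in_itv/= -ler_norml.
by have := H i Logic.I; rewrite /= in_itv/= -ler_norml.
Qed.

Lemma lebesgue_rV_box_lty n (M : R) :
  (lebesgue_rV n [set x : 'rV[R]_n | (forall i, `|x ord0 i| <= M)%R] < +oo)%E.
Proof.
elim: n => [|n IH]; first by rewrite /= diracE ltry.
rewrite /= /lebesgue_succ /pushforward.
rewrite (_ : _ @^-1` _ = [set t : R | `|t| <= M] `*`
   [set x : 'rV[R]_n | (forall i, `|x ord0 i| <= M)%R]).
  rewrite product_measure1E/=.
  - rewrite lte_mul_pinfty//.
    + rewrite ge0_fin_numE//.
      rewrite (_ : [set t | _] = `[- M, M]%classic) ?lebesgue_measure_itv/=.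
        by case: ifPn => // _; rewrite ltry.
      by apply/seteqP; split=> t /=; rewrite in_itv/= ler_norml.
  - rewrite (_ : [set t | _] = `[- M, M]%classic)//.
    by apply/seteqP; split=> t /=; rewrite in_itv/= ler_norml.
  - exact: measurable_box.
apply/seteqP; split=> -[a x] /=.
  move=> H; split; first by have := H ord0; rewrite mxE unlift_none.
  by move=> i /=; have := H (lift ord0 i); rewrite mxE liftK.
by move=> [Ha Hx] i; rewrite mxE; case: unliftP => [j _|_ //]; exact: Hx.
Qed.

Lemma bounded_lebesgue_rV_lty n (D : set 'rV[R]_n) : measurable D ->
  bounded_set D -> (lebesgue_rV n D < +oo)%E.
Proof.
move=> mD [M [_ /(_ (M + 1))]]; rewrite ltrDl ltr01 => /(_ isT) bD.
apply: le_lt_trans (lebesgue_rV_box_lty n (M + 1)).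
apply: le_measure; rewrite ?inE//; last first.
  move=> x /bD Hx i; apply: le_trans Hx.
  rewrite [leRHS]/Num.Def.normr /= mx_normrE; apply/bigmax_geP; right => /=.
  by exists (ord0, i).
exact: measurable_box.
Qed.

End lebesgue_rV_theory.

(** * The integral of a compactly supported partial derivative *)

Section integration_by_parts.
Context {R : realType}.

(** Along such a g the difference quotients of F \o g and of F coincide; used
    with g gluing a fixed coordinate to the remaining ones. *)
Lemma is_derive_affine (U V : normedModType R) (g : U -> V) (F : V -> R)
    (x v : U) (w : V) (df : R) :
  (forall h : R, g (h *: v + x) = h *: w + g x) ->
  is_derive (g x) w F df -> is_derive x v (F \o g) df.
Proof.
move=> gE [dF DF].
have E : (fun h : R => h^-1 *: (((F \o g) \o shift x) (h *: v) - (F \o g) x)) =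
         (fun h : R => h^-1 *: ((F \o shift (g x)) (h *: w) - F (g x))).
  by apply/funext => h /=; rewrite gE.
by split; [rewrite /derivable E|rewrite /derive E].
Qed.

(** The fundamental theorem of calculus on an interval that contains the support
    in its interior. *)
Lemma integral_derive_eq0 (F F' : R -> R) (M : R) :
  (forall t : R, is_derive t 1 F (F' t)) -> continuous F' ->
  (forall t, M < `|t| -> F t = 0 /\ F' t = 0) ->
  (\int[lebesgue_measure]_t (F' t)%:E = 0)%E.
Proof.
move=> dF cF' F0; pose K : R := `|M| + 1.
have K0 : 0 < K by rewrite ltr_wpDl.
have MK : M < K by rewrite (le_lt_trans (ler_norm M))// ltrDl.
rewrite (_ : (fun t => (F' t)%:E) = (EFin \o F') \_ `[- K, K]); last first.
  apply/funext => t; rewrite patchE; case: ifPn => //.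
  rewrite notin_setE /= in_itv/= -ler_norml => /negP; rewrite -ltNge => Kt.
  by have [_ ->] := F0 t (lt_trans MK Kt).
rewrite -integral_mkcond.
have cF t : {for t, continuous F}.
  by apply/differentiable_continuous/derivable1_diffP; have [] := dF t.
have KK : - K < K by rewrite gtrN.
have cF'K : {within `[- K, K], continuous F'} by exact: continuous_subspaceT.
have dFK : derivable_oo_LRcontinuous F (- K) K.
  split.
  - by move=> t _; have [] := dF t.
  - apply: cvg_at_right_filter; exact: cF.
  - apply: cvg_at_left_filter; exact: cF.
have dFE : {in `]- K, K[, derive1 F =1 F'}.
  by move=> t _; rewrite derive1E; have [_ ->] := dF t.
rewrite (continuous_FTC2 KK cF'K dFK dFE).
have MK' : M < `|K| by rewrite gtr0_norm.
have MNK : M < `|- K| by rewrite normrN.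
by rewrite (F0 _ MK').1 (F0 _ MNK).1 subee.
Qed.

Lemma bounded_support_integrable n (F : 'rV[R]_n -> R) (C M : R) :
  measurable_fun setT F -> (forall x, `|F x| <= C) ->
  (forall (x : 'rV[R]_n) j, M < `|x ord0 j| -> F x = 0) ->
  (lebesgue_rV n).-integrable setT (EFin \o F).
Proof.
move=> mF FC F0.
pose D := [set x : 'rV[R]_n | forall i, `|x ord0 i| <= M].
have mD : measurable D by exact: measurable_box.
rewrite (_ : EFin \o F = (EFin \o F) \_ D); last first.
  apply/funext => x; rewrite patchE; case: ifPn => //.
  rewrite notin_setE => /existsNP[j /negP]; rewrite -ltNge => Mj.
  by rewrite /= (F0 x j Mj).
apply: (iffLR (integrable_mkcond _ mD)); apply: (measurable_bounded_integrable mD).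
- exact: lebesgue_rV_box_lty.
- exact: measurable_funTS.
- by exists C; split; [exact: num_real|move=> C' CC' x _; exact: le_trans (ltW CC')].
Qed.

(** Divergence theorem for compactly supported functions.  By Fubini, the
    direction i is either the first coordinate, where the inner integral is
    one-dimensional and vanishes by the fundamental theorem of calculus, or one of
    the others, where the inner integral vanishes by induction.  Continuity of the
    derivative is required along lines only, a form that is inherited by the
    slices. *)
Lemma integral_partial_eq0 n (i : 'I_n) (F F' : 'rV[R]_n -> R) (C M : R) :
  (forall x, is_derive x (delta_mx ord0 i) F (F' x)) ->
  (forall x, continuous (fun t : R => F' (t *: delta_mx ord0 i + x))) ->
  measurable_fun setT F' -> (forall x, `|F' x| <= C) ->
  (forall (x : 'rV[R]_n) j, M < `|x ord0 j| -> F x = 0 /\ F' x = 0) ->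
  (\int[lebesgue_rV n]_x (F' x)%:E = 0)%E.
Proof.
elim: n i F F' => [[]//|n IH] i F F' dF cF' mF' FC F0.
have iF' : (lebesgue_rV n.+1).-integrable setT (EFin \o F').
  apply: (@bounded_support_integrable _ _ C M) => // x j Mj.
  by have [] := F0 x j Mj.
have [iFc ->] := integral_lebesgue_rVS iF'.
have cons0E (y : 'rV[R]_n) (h t : R) :
    cons_rV (h + t, y) = h *: delta_mx ord0 ord0 + cons_rV (t, y).
  apply/rowP => k; rewrite !mxE; case: unliftP => [j ->|->] /=.
    by rewrite ?eqxx /= ?mulr0 ?add0r.
  by rewrite ?eqxx /= ?mulr1.
have consE (j : 'I_n) (a h : R) (y : 'rV[R]_n) :
    cons_rV (a, h *: delta_mx ord0 j + y) =
      h *: delta_mx ord0 (lift ord0 j) + cons_rV (a, y).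
  apply/rowP => k; rewrite !mxE; case: unliftP => [l ->|->] /=.
    by rewrite !mxE /= (inj_eq lift_inj).
  by rewrite ?eqxx /= ?mulr0 ?add0r.
have cons_coord0 (t : R) (y : 'rV[R]_n) : cons_rV (t, y) ord0 ord0 = t.
  by rewrite mxE unlift_none.
have cons_coordS (t : R) (y : 'rV[R]_n) j :
    cons_rV (t, y) ord0 (lift ord0 j) = y ord0 j.
  by rewrite mxE liftK.
(* Integrate last with respect to the first coordinate when i is another one, and
   first with respect to it otherwise. *)
case: (unliftP ord0 i) => [j ij|i0].
  rewrite -(integral12_prod_meas1 iFc); apply: integral0_eq => a _.
  rewrite /fubini_F.
  apply: (IH j (fun y => F (cons_rV (a, y))) (fun y => F' (cons_rV (a, y)))).
  - move=> y; apply: (@is_derive_affine _ _ (fun y => cons_rV (a, y)) F y _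
      (delta_mx ord0 i)) => //.
    by move=> h; rewrite ij consE.
  - move=> y.
    rewrite (_ : (fun t => _) =
      (fun t : R => F' (t *: delta_mx ord0 i + cons_rV (a, y)))) //.
    by apply/funext => t; rewrite consE ij.
  - apply: measurableT_comp => //; apply: measurableT_comp (@measurable_cons_rV R n) _.
    exact: measurable_pair1.
  - by move=> y.
  - by move=> y k Mk; apply: (F0 _ (lift ord0 k)); rewrite cons_coordS.
rewrite -(integral21_prod_meas1 iFc); apply: integral0_eq => y _.
rewrite /fubini_G; apply: (@integral_derive_eq0 (fun t => F (cons_rV (t, y)))
  (fun t => F' (cons_rV (t, y))) M).
- move=> t; apply: (@is_derive_affine _ _ (fun t : R => cons_rV (t, y)) F t _
    (delta_mx ord0 i)) => //.
  by move=> h; rewrite i0 -cons0E [h *: _]mulr1.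
- rewrite (_ : (fun t => _) =
    (fun t : R => F' (t *: delta_mx ord0 i + cons_rV (0, y)))) //.
  by apply/funext => t; rewrite i0 -cons0E addr0.
- by move=> t Mt; apply: (F0 _ ord0); rewrite cons_coord0.
Qed.

End integration_by_parts.

(** * A smooth approximation of the positive part *)

Section softplus.
Context {R : realType}.
Implicit Types e a b t : R.

(** The function t |-> e ln (1 + exp (t / e)) tends to the positive part of t as e
    tends to 0.  Subtracting its value at 0 makes its composition with a compactly
    supported function compactly supported. *)
Definition softplus e t : R := e * (ln (1 + expR (t / e)) - ln 2).

(** The derivative of the softplus, that is exp (t / e) / (1 + exp (t / e)). *)
Definition logistic e t : R := 1 - (1 + expR (t / e))^-1.

Let den_gt0 e t : 0 < 1 + expR (t / e).
Proof. by rewrite addr_gt0// expR_gt0. Qed.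

Let is_derive_den e t : 0 < e ->
  is_derive t (1 : R) (fun u => 1 + expR (u / e)) (expR (t / e) * e^-1).
Proof.
move=> e0.
have dE : is_derive t (1 : R) (fun u => expR (u / e)) (expR (t / e) * e^-1).
  apply: (@is_derive1_comp _ expR (fun u => u / e) t (expR (t / e)) e^-1
    (is_derive_expR _)).
  have := is_deriveM (is_derive_id t (1 : R)) (is_derive_cst e^-1 t (1 : R)).
  by move/is_derive_eq; apply; rewrite scaler0 add0r [LHS]mulr1.
have := is_deriveD (is_derive_cst (1 : R) t (1 : R)) dE.
by move/is_derive_eq; apply; rewrite add0r.
Qed.

Lemma softplus0 e : softplus e 0 = 0.
Proof. by rewrite /softplus mul0r expR0 subrr mulr0. Qed.

Lemma is_derive_softplus e t : 0 < e ->
  is_derive t 1 (softplus e) (logistic e t).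
Proof.
move=> e0; have d0 := den_gt0 e t.
have d1E := is_derive_den t e0.
have dln : is_derive t (1 : R) (fun u => ln (1 + expR (u / e)))
    ((1 + expR (t / e))^-1 * (expR (t / e) * e^-1)).
  exact: (@is_derive1_comp _ (@ln R) (fun u => 1 + expR (u / e)) t
    (1 + expR (t / e))^-1 _ (is_derive1_ln d0) d1E).
have := is_deriveZ e (is_deriveB dln (is_derive_cst (ln 2 : R) t (1 : R))).
move/is_derive_eq; apply; rewrite subr0 /logistic /GRing.scale/=.
by field; rewrite !gt_eqF.
Qed.

Lemma is_derive_logistic e t : 0 < e ->
  is_derive t 1 (logistic e) (e^-1 * (logistic e t * (1 - logistic e t))).
Proof.
move=> e0; have d0 := den_gt0 e t.
have dV := @is_deriveV _ (fun u => 1 + expR (u / e)) t _ _ (lt0r_neq0 d0)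
  (is_derive_den t e0).
have := is_deriveB (is_derive_cst (1 : R) t (1 : R)) dV.
move/is_derive_eq; apply; rewrite sub0r /logistic /GRing.scale/=.
by field; rewrite !gt_eqF.
Qed.

Lemma logistic_ge0 e t : 0 <= logistic e t.
Proof. by rewrite subr_ge0 invf_le1// lerDl expR_ge0. Qed.

Lemma logistic_le1 e t : logistic e t <= 1.
Proof. by rewrite gerBl invr_ge0 ltW. Qed.

(** With A = exp (a / e) <= B = exp (b / e), the difference of the two values is
    (B - A) / ((1 + A) (1 + B)) <= 1 - A / B = 1 - exp ((a - b) / e), and
    1 + x <= exp x concludes. *)
Lemma logistic_lipschitz e a b : 0 < e ->
  `|logistic e a - logistic e b| <= e^-1 * `|a - b|.
Proof.
move=> e0; wlog ab : a b / a <= b.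
  move=> H; have [|/ltW ba] := leP a b; first exact: H.
  by rewrite distrC [`|a - b|]distrC; exact: H.
have a0 := expR_gt0 (a / e); have b0 := expR_gt0 (b / e).
have ab' : expR (a / e) <= expR (b / e) by rewrite ler_expR ler_pM2r ?invr_gt0.
have -> : logistic e a - logistic e b =
    - ((expR (b / e) - expR (a / e)) / ((1 + expR (a / e)) * (1 + expR (b / e)))).
  by rewrite /logistic; field; rewrite !gt_eqF.
rewrite normrN ger0_norm; last first.
  by rewrite divr_ge0 ?subr_ge0// ltW// mulr_gt0.
apply: (@le_trans _ _ (1 - expR ((a - b) / e))).
  rewrite [(a - b) / e]mulrBl expRB ler_pdivrMr ?mulr_gt0//.
  set A := expR (a / e) in a0 ab' *; set B := expR (b / e) in b0 ab' *.
  have -> : (1 - A / B) * ((1 + A) * (1 + B)) =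
      (B - A) * ((1 + A) * (1 + B) / B) by field; rewrite gt_eqF.
  rewrite ler_peMr ?subr_ge0// ler_pdivlMr// mul1r mulrDl mul1r.
  by rewrite addrAC lerDr addr_ge0// mulr_ge0 ?ltW// addr_gt0.
rewrite ler0_norm ?subr_le0// opprB [e^-1 * _]mulrC -(opprB a b) mulNr.
by rewrite lerBlDr -lerBlDl opprK expR_ge1Dx.
Qed.

(** The slopes of the softplus are between 0 and 1: monotonicity is that of ln and
    exp, and the upper bound is 1 + exp (b / e) <= exp ((b - a) / e) (1 + exp (a / e)). *)
Lemma softplus_homo e a b : 0 < e -> a <= b ->
  0 <= softplus e b - softplus e a <= b - a.
Proof.
move=> e0 ab.
have a0 := expR_gt0 (a / e); have b0 := expR_gt0 (b / e).
have da := den_gt0 e a; have db := den_gt0 e b.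
have ab' : expR (a / e) <= expR (b / e) by rewrite ler_expR ler_pM2r ?invr_gt0.
have -> : softplus e b - softplus e a =
    e * (ln (1 + expR (b / e)) - ln (1 + expR (a / e))).
  by rewrite /softplus; ring.
rewrite mulr_ge0 ?(ltW e0)//=; last by rewrite subr_ge0 ler_ln ?posrE// lerD2l.
rewrite -ler_pdivlMl// lerBlDr.
have -> : e^-1 * (b - a) = ln (expR ((b - a) / e)) by rewrite expRK mulrC.
rewrite -lnM ?posrE ?expR_gt0// ler_ln ?posrE ?mulr_gt0 ?expR_gt0//.
rewrite mulrDr mulr1 -expRD -mulrDl subrK lerD2r -[leLHS](expR0).
by rewrite ler_expR divr_ge0 ?subr_ge0// ltW.
Qed.

Lemma softplus_lipschitz e a b : 0 < e ->
  `|softplus e a - softplus e b| <= `|a - b|.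
Proof.
move=> e0; wlog ab : a b / a <= b.
  move=> H; have [|/ltW ba] := leP a b; first exact: H.
  by rewrite distrC [`|a - b|]distrC; exact: H.
have /andP[h1 h2] := softplus_homo e0 ab.
by rewrite distrC [`|a - b|]distrC !ger0_norm// subr_ge0.
Qed.

Lemma softplus_mul_ge0 e a b : 0 < e ->
  0 <= (a - b) * (softplus e a - softplus e b).
Proof.
move=> e0; have [ab|/ltW ba] := leP a b.
  have /andP[h1 _] := softplus_homo e0 ab.
  by rewrite -mulrNN !opprB mulr_ge0// subr_ge0.
have /andP[h1 _] := softplus_homo e0 ba.
by rewrite mulr_ge0// subr_ge0.
Qed.

(** The upper bound comes from the slopes in [0, 1] and the value 0 at 0; the lower
    one from ln (1 + exp (t / e)) >= max (0, t / e) and ln 2 <= 1. *)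
Lemma softplus_near e t : 0 < e ->
  Num.max 0 t - e <= softplus e t <= Num.max 0 t.
Proof.
move=> e0; apply/andP; split.
  have ln2 : ln 2 <= 1 :> R by have := @le_ln1Dx R 1; rewrite -[1 + 1]/2; apply; lra.
  have H : Num.max 0 t <= e * ln (1 + expR (t / e)).
    rewrite ge_max; apply/andP; split.
      by rewrite mulr_ge0 ?(ltW e0)// ln_ge0// lerDl expR_ge0.
    rewrite -ler_pdivrMl// -[leLHS](expRK) ler_ln ?posrE ?expR_gt0//.
    by rewrite mulrC lerDr.
  rewrite /softplus mulrBr lerB// -[leRHS]mulr1 ler_pM2l//.
have [t0|/ltW t0] := leP t 0.
  have /andP[+ _] := softplus_homo e0 t0.
  by rewrite softplus0 sub0r oppr_ge0.
have /andP[_] := softplus_homo e0 t0.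
by rewrite softplus0 !subr0.
Qed.

End softplus.

(** * Stability of smooth functions and test functions *)

Section smooth_closure.
Context {R : realType} {n : nat}.
Implicit Types (f g phi : 'rV[R]_n -> R) (i : 'I_n) (x : 'rV[R]_n).

Lemma smooth_differentiable f x : smooth f -> differentiable f x.
Proof. by move/(_ [::] x). Qed.

Lemma smooth_partial i f : smooth f -> smooth (partial i f).
Proof.
move=> sf s x; rewrite (_ : foldr _ _ s = foldr (@partial R n) f (rcons s i)).
  exact: sf.
by rewrite foldr_rcons.
Qed.

(** Coinduction principle for smoothness: it is enough to place a function in a
    family of differentiable functions that is stable under partial derivatives. *)
Lemma smooth_stable (S : ('rV[R]_n -> R) -> Prop) :
  (forall f, S f -> forall x, differentiable f x) ->
  (forall f i, S f -> S (partial i f)) ->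
  forall f, S f -> smooth f.
Proof.
move=> Sd Sp f Sf s; apply: Sd.
by elim: s => [//|i s IH] /=; exact: Sp.
Qed.

Lemma smooth_cst (c : R) : smooth (cst c : 'rV[R]_n -> R).
Proof.
apply: (@smooth_stable (fun f => exists c, f = cst c)); last by exists c.
  by move=> _ [a ->] x; exact: differentiable_cst.
by move=> _ i [a ->]; exists 0; apply/funext => x; rewrite /partial derive_cst.
Qed.

Lemma partialB i f g : (forall x, differentiable f x) ->
  (forall x, differentiable g x) ->
  partial i (f \- g) = partial i f \- partial i g.
Proof.
by move=> df dg; apply/funext => x; rewrite /partial deriveB//; exact: diff_derivable.
Qed.

Lemma partialM i f g : (forall x, differentiable f x) ->
  (forall x, differentiable g x) ->
  partial i (f \* g) = (f \* partial i g) \+ (g \* partial i f).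
Proof.
by move=> df dg; apply/funext => x; rewrite /partial deriveM//; exact: diff_derivable.
Qed.

Lemma partial_comp i (P P' : R -> R) phi : (forall t : R, is_derive t 1 P (P' t)) ->
  (forall x, differentiable phi x) ->
  (forall x, differentiable (P \o phi) x) /\
  partial i (P \o phi) = (P' \o phi) \* partial i phi.
Proof.
move=> dP dphi.
have dPd t : differentiable P t by apply/derivable1_diffP; have [] := dP t.
have dc x : differentiable (P \o phi) x by exact: differentiable_comp.
split => //; apply/funext => x; rewrite /partial deriveE// diff_comp//=.
rewrite diff1E// derive1E; have [_ ->] := dP (phi x).
by rewrite deriveE// mulrC.
Qed.

Lemma smoothB f g : smooth f -> smooth g -> smooth (f \- g).
Proof.
move=> sf sg.
apply: (@smooth_stable (fun h => exists a b, [/\ smooth a, smooth b & h = a \- b])).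
- by move=> _ [a [b [sa sb ->]]] x; apply: differentiableB; exact: smooth_differentiable.
- move=> _ i [a [b [sa sb ->]]].
  exists (partial i a), (partial i b); split; try exact: smooth_partial.
  by apply: partialB => x; exact: smooth_differentiable.
- by exists f, g.
Qed.

(** Since logistic' = logistic (1 - logistic) / e, the functions built from smooth
    ones and from logistic \o phi by differences and products form a family that is
    stable under partial derivatives; it contains those of softplus \o phi. *)
Inductive logistic_alg (e : R) phi : ('rV[R]_n -> R) -> Prop :=
| logistic_alg_smooth f : smooth f -> logistic_alg e phi f
| logistic_alg_gen : logistic_alg e phi (logistic e \o phi)
| logistic_alg_sub f g :
    logistic_alg e phi f -> logistic_alg e phi g -> logistic_alg e phi (f \- g)
| logistic_alg_mul f g :
    logistic_alg e phi f -> logistic_alg e phi g -> logistic_alg e phi (f \* g).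

Lemma logistic_alg_differentiable e phi f : 0 < e -> smooth phi ->
  logistic_alg e phi f -> forall x, differentiable f x.
Proof.
move=> e0 sphi; elim=> [h sh x|x|h k _ IHh _ IHk x|h k _ IHh _ IHk x].
- exact: smooth_differentiable.
- apply: differentiable_comp; first exact: smooth_differentiable.
  by apply/derivable1_diffP; have [] := is_derive_logistic (phi x) e0.
- exact: differentiableB.
- exact: differentiableM.
Qed.

Lemma logistic_alg_partial e phi f i : 0 < e -> smooth phi ->
  logistic_alg e phi f -> logistic_alg e phi (partial i f).
Proof.
move=> e0 sphi Af; have lad := logistic_alg_differentiable e0 sphi.
elim: Af => [h sh||h k Ah IHh Ak IHk|h k Ah IHh Ak IHk].
- by apply: logistic_alg_smooth; exact: smooth_partial.
- have [_ ->] := @partial_comp i (logistic e) _ phi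
    (fun t => is_derive_logistic t e0) (fun x => smooth_differentiable x sphi).
  apply: logistic_alg_mul; last first.
    by apply: logistic_alg_smooth; exact: smooth_partial.
  apply: (@logistic_alg_mul _ _ (cst e^-1)
     (fun x => logistic e (phi x) * (1 - logistic e (phi x)))).
    by apply: logistic_alg_smooth; exact: smooth_cst.
  apply: (@logistic_alg_mul _ _ (logistic e \o phi)
     (fun x => 1 - logistic e (phi x))); first exact: logistic_alg_gen.
  apply: (@logistic_alg_sub _ _ (cst 1) (logistic e \o phi)).
    by apply: logistic_alg_smooth; exact: smooth_cst.
  exact: logistic_alg_gen.
- by rewrite partialB; [exact: logistic_alg_sub|exact: lad|exact: lad].
- rewrite partialM; [|exact: lad|exact: lad].
  rewrite (_ : _ \+ _ =
     (h \* partial i k) \- ((cst 0) \- (k \* partial i h))); last first.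
    by apply/funext => x /=; rewrite sub0r opprK.
  apply: logistic_alg_sub; first exact: logistic_alg_mul.
  apply: logistic_alg_sub; last exact: logistic_alg_mul.
  by apply: logistic_alg_smooth; exact: smooth_cst.
Qed.

Lemma partial_softplus e phi i : 0 < e -> smooth phi ->
  partial i (softplus e \o phi) = (logistic e \o phi) \* partial i phi.
Proof.
move=> e0 sphi; have [] := @partial_comp i (softplus e) _ phi
  (fun t => is_derive_softplus t e0) (fun x => smooth_differentiable x sphi).
by [].
Qed.

Lemma smooth_softplus e phi : 0 < e -> smooth phi -> smooth (softplus e \o phi).
Proof.
move=> e0 sphi.
apply: (@smooth_stable (fun f => f = softplus e \o phi \/ logistic_alg e phi f)).
- move=> f [->|Af]; last exact: logistic_alg_differentiable Af.
  move=> x; apply: differentiable_comp; first exact: smooth_differentiable.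
  by apply/derivable1_diffP; have [] := is_derive_softplus (phi x) e0.
- move=> f i [->|Af]; right; last exact: logistic_alg_partial.
  rewrite partial_softplus//; apply: logistic_alg_mul; first exact: logistic_alg_gen.
  by apply: logistic_alg_smooth; exact: smooth_partial.
- by left.
Qed.

Lemma smooth_continuous f : smooth f -> continuous f.
Proof.
by move=> sf x; apply: differentiable_continuous; exact: smooth_differentiable.
Qed.

Lemma smooth_measurable f : smooth f -> measurable_fun setT f.
Proof. by move=> sf; apply: continuous_measurable_rV; exact: smooth_continuous. Qed.

Lemma is_derive_partial f i x : (forall x, differentiable f x) ->
  is_derive x (delta_mx ord0 i) f (partial i f x).
Proof. by move=> df; split => //; exact: diff_derivable. Qed.

End smooth_closure.

Section test_functions.
Context {R : realType} {n : nat} (Omega : set 'rV[R]_n).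
Implicit Types (f phi : 'rV[R]_n -> R) (i : 'I_n) (x : 'rV[R]_n).

Lemma partial_out_supp phi i x : ~ closure [set x | phi x != 0] x ->
  partial i phi x = 0.
Proof.
move=> nK; have near0 : \forall y \near x, phi y = cst 0 y.
  have : open (~` closure [set x | phi x != 0]) by apply/closed_openC/closed_closure.
  rewrite openE => /(_ x nK); rewrite /interior; apply: filterS => y nKy.
  by apply/eqP/negPn/negP => py; apply: nKy; exact: subset_closure.
by rewrite /partial (near_eq_derive _ near0) derive_cst.
Qed.

Lemma test_function_sub_supp phi psi : test_function Omega phi -> smooth psi ->
  (forall x, ~ closure [set x | phi x != 0] x -> psi x = 0) ->
  test_function Omega psi.
Proof.
move=> [_ cphi sphi] spsi psi0.
have sub : closure [set x | psi x != 0] `<=` closure [set x | phi x != 0].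
  rewrite [X in _ `<=` X](iffLR (closure_id _)); last exact: closed_closure.
  apply: closure_subset => x /= px; apply: contrapT => /psi0 px0.
  by rewrite px0 eqxx in px.
split => //; last exact: subset_trans sphi.
by apply: (subclosed_compact _ cphi sub); exact: closed_closure.
Qed.

Lemma test_functionB phi psi : test_function Omega phi ->
  test_function Omega psi -> test_function Omega (phi \- psi).
Proof.
move=> [sphi cphi Ophi] [spsi cpsi Opsi].
have sub : closure [set x | (phi \- psi) x != 0] `<=`
    closure [set x | phi x != 0] `|` closure [set x | psi x != 0].
  rewrite -closureU; apply: closure_subset => x /=.
  apply: contra_neqP => /not_orP[/negP/negPn/eqP-> /negP/negPn/eqP->].
  by rewrite subrr.
split; first exact: smoothB.
- apply: (subclosed_compact _ (compactU cphi cpsi) sub).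
  exact: closed_closure.
- by apply: (subset_trans sub) => x [/Ophi|/Opsi].
Qed.

Lemma test_function_softplus e phi : 0 < e -> test_function Omega phi ->
  test_function Omega (softplus e \o phi).
Proof.
move=> e0 tphi; have [sphi _ _] := tphi.
apply: (test_function_sub_supp tphi); first exact: smooth_softplus.
move=> x nK; rewrite /= (_ : phi x = 0) ?softplus0//.
by apply/eqP/negPn/negP => px; apply: nK; exact: subset_closure.
Qed.

Lemma test_function_out phi x : test_function Omega phi -> ~ Omega x ->
  phi x = 0 /\ forall i, partial i phi x = 0.
Proof.
move=> [sphi cphi Ophi] nOx.
have nK : ~ closure [set x | phi x != 0] x by move=> /Ophi.
split; last by move=> i; exact: partial_out_supp.
by apply/eqP/negPn/negP => px; apply: nK; exact: subset_closure.
Qed.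

Lemma test_function_partial phi i : test_function Omega phi ->
  test_function Omega (partial i phi).
Proof.
move=> tphi; have [sphi _ _] := tphi.
apply: (test_function_sub_supp tphi); first exact: smooth_partial.
by move=> x; exact: partial_out_supp.
Qed.

Lemma test_function_bounded phi : test_function Omega phi ->
  exists C : R, forall x, `|phi x| <= C.
Proof.
move=> [sphi cphi _].
have /compact_bounded [M [_ bM]] : compact (phi @` closure [set x | phi x != 0]).
  apply: continuous_compact => //; apply: continuous_subspaceT.
  exact: smooth_continuous.
exists (`|M| + 1) => x; have [->|px] := eqVneq (phi x) 0.
  by rewrite normr0 addr_ge0.
apply: bM; first by rewrite (le_lt_trans (ler_norm M))// ltrDl.
by exists x => //; exact: subset_closure.
Qed.

(** The function phi * eta has compact support in Omega, whatever the behaviour of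
    eta near the boundary, so that eta may be a coordinate function. *)
Lemma test_function_by_parts phi (eta : 'rV[R]_n -> R) i :
  bounded_set Omega -> test_function Omega phi ->
  (forall x, differentiable eta x) ->
  continuous (partial i eta) ->
  (exists C : R, forall x, Omega x -> `|eta x| <= C) ->
  (exists C : R, forall x, Omega x -> `|partial i eta x| <= C) ->
  (\int[lebesgue_rV n]_x (phi x * partial i eta x + partial i phi x * eta x)%:E
    = 0)%E.
Proof.
move=> [M0 [_ bM]] tphi deta ceta [C1 C1P] [C2 C2P].
have [sphi _ _] := tphi.
have [B1 B1P] := test_function_bounded tphi.
have [B2 B2P] := test_function_bounded (test_function_partial i tphi).
have dphi x : differentiable phi x := smooth_differentiable x sphi.
have cont_eta : continuous eta by move=> x; exact: differentiable_continuous.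
have cont_F' : continuous (fun x => phi x * partial i eta x + partial i phi x * eta x).
  move=> x.
  have c1 := cvgM (@smooth_continuous _ _ _ sphi x) (ceta x).
  have c2 := cvgM (@smooth_continuous _ _ _ (smooth_partial i sphi) x) (cont_eta x).
  exact: (cvgD (c1 _) (c2 _)).
apply: (@integral_partial_eq0 R n i (phi \* eta) _ (B1 * `|C2| + B2 * `|C1|) (M0 + 1)).
- move=> x; have := is_deriveM (is_derive_partial i x dphi) (is_derive_partial i x deta).
  by move/is_derive_eq; apply; congr (_ + _); rewrite mulrC.
- move=> x t.
  apply: (@continuous_comp _ _ _ (fun t : R => t *: delta_mx ord0 i + x)
    (fun x => phi x * partial i eta x + partial i phi x * eta x)); last exact: cont_F'.
  apply: cvgD; last exact: cvg_cst.
  by apply: cvgZr_tmp; exact: cvg_id.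
- exact: continuous_measurable_rV.
- move=> x; have [Ox|nOx] := pselect (Omega x).
    rewrite (le_trans (ler_normD _ _))// !normrM.
    rewrite lerD// ler_pM// ?B1P ?B2P//.
      by rewrite (le_trans (C2P _ Ox))// ler_norm.
    by rewrite (le_trans (C1P _ Ox))// ler_norm.
  have [-> p0] := test_function_out tphi nOx; rewrite p0 !mul0r addr0 normr0.
  by rewrite addr_ge0// mulr_ge0// (le_trans _ (B1P x), le_trans _ (B2P x)).
- move=> x j Mj.
  have nOx : ~ Omega x.
    move=> /(bM (M0 + 1)); rewrite ltrDl ltr01 => /(_ isT) xM.
    move: Mj; rewrite ltNge => /negP; apply; apply: le_trans xM.
    rewrite [leRHS]/Num.Def.normr /= mx_normrE; apply/bigmax_geP; right => /=.
    by exists (ord0, j).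
  have [p0 pp0] := test_function_out tphi nOx.
  by rewrite /= p0 pp0 !mul0r addr0.
Qed.

End test_functions.

(** * Mean-square convergence *)

Section square_integrable.
Context d (T : measurableType d) (R : realType).
Variable mu : {measure set T -> \bar R}.
Implicit Types (f g : T -> R) (h : nat -> T -> R).

(** The integral of a nonnegative function is by definition a supremum over the
    simple functions that it dominates, hence it is monotone. *)
Lemma ge0_integral_mono (D : set T) (f g : T -> \bar R) :
  (forall x, D x -> 0 <= f x)%E -> (forall x, D x -> f x <= g x)%E ->
  (\int[mu]_(x in D) f x <= \int[mu]_(x in D) g x)%E.
Proof.
move=> f0 fg; rewrite !ge0_integralE//; last first.
  by move=> x Dx; exact: le_trans (f0 x Dx) (fg x Dx).
apply: ge_ereal_sup => _ [k kf <-]; apply: ereal_sup_ubound; exists k => // x.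
apply: (le_trans (kf x)); rewrite !patchE; case: ifPn => // /set_mem Dx.
exact: fg.
Qed.

Lemma integral_mono (D : set T) (f g : T -> \bar R) :
  (forall x, D x -> f x <= g x)%E ->
  (\int[mu]_(x in D) f x <= \int[mu]_(x in D) g x)%E.
Proof.
move=> fg; rewrite integralE [leRHS]integralE leeB//.
- apply: ge0_integral_mono => // x Dx.
  by rewrite (@funepos_le _ _ [set x]) ?inE// => y /set_mem ->; exact: fg.
- apply: ge0_integral_mono => // x Dx.
  by rewrite (@funeneg_le _ _ [set x]) ?inE// => y /set_mem ->; exact: fg.
Qed.

(** The difference g - f is almost everywhere equal to its absolute value. *)
Lemma ae_le_integral f g : mu.-integrable setT (EFin \o f) ->
  mu.-integrable setT (EFin \o g) -> {ae mu, forall x, f x <= g x} ->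
  (\int[mu]_x (f x)%:E <= \int[mu]_x (g x)%:E)%E.
Proof.
move=> fi gi fg; rewrite -sube_ge0; last first.
  by apply/orP; left; exact: (integrable_fin_num measurableT fi).
rewrite -integralB_EFin//.
have mfg : measurable_fun setT (fun x => ((g x)%:E - (f x)%:E)%E).
  by apply: emeasurable_funB; [exact: measurable_int gi|exact: measurable_int fi].
rewrite (ae_eq_integral (fun x => `|(g x)%:E - (f x)%:E|%E))//.
- exact: integral_ge0.
- exact: measurableT_comp.
- apply: filterS fg => x fgx _; rewrite gee0_abs// -EFinB lee_fin.
  by rewrite subr_ge0.
Qed.

Lemma Lnorm2_sqr f : ((Lnorm mu 2%:E (EFin \o f)) `^ 2 =
  \int[mu]_x (f x ^+ 2)%:E)%E.
Proof.
rewrite poweR_Lnorm ?pnatr_eq0//; apply: eq_integral => x _ /=.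
by rewrite powR_mulrn// real_normK// num_real.
Qed.

Lemma Lfun2P f : f \in Lfun mu 2%:E <->
  measurable_fun setT f /\ (\int[mu]_x (f x ^+ 2)%:E < +oo)%E.
Proof.
split.
  move=> /[dup] /Lfun2_integrable_sqr /integrableP[_ fi].
  rewrite inE => /andP[/[!inE]/= mf _]; split => //.
  apply: le_lt_trans fi; apply: ge0_integral_mono => x _ /=.
    by rewrite lee_fin sqr_ge0.
  by rewrite lee_fin ler_norm.
move=> [mf fi]; rewrite inE; apply/andP; split; rewrite inE//=.
rewrite /finite_norm; apply: (@lty_poweRy _ _ 2) => //.
by rewrite Lnorm2_sqr.
Qed.

(** Convergence to 0 in mean square, in the form in which it is produced and
    consumed by estimates of integrals of squares; see [Lnorm2_cvg0P]. *)
Definition L2cvg0 h := forall e : R, 0 < e ->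
  \forall k \near \oo, (\int[mu]_x (h k x ^+ 2)%:E <= e%:E)%E.

Lemma Lnorm2_cvg0P h :
  Lnorm mu 2%:E (EFin \o h k) @[k --> \oo] --> 0%E <-> L2cvg0 h.
Proof.
split=> [/fine_cvgP[fh /cvgr0Pnorm_lt h0] e e0|h0].
  have se0 : 0 < Num.sqrt e by rewrite sqrtr_gt0.
  have := h0 _ se0; move: fh; apply: filterS2 => k fk hk.
  rewrite -Lnorm2_sqr -(fineK fk) poweR_EFin lee_fin powR_mulrn//; last first.
    by rewrite fine_ge0// Lnorm_ge0.
  rewrite -(sqr_sqrtr (ltW e0)) lerXn2r// ?nnegrE ?sqrtr_ge0//; last first.
    by rewrite (le_trans (ler_norm _))// ltW.
  by rewrite fine_ge0// Lnorm_ge0.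
have H e : 0 < e -> \forall k \near \oo, (Lnorm mu 2%:E (EFin \o h k) <= e%:E)%E.
  move=> e0; have e20 : 0 < e ^+ 2 by rewrite exprn_gt0.
  have := h0 _ e20; apply: filterS => k; rewrite -Lnorm2_sqr => hk.
  have i2 : 0 <= 2^-1 :> R by rewrite invr_ge0.
  have := gt0_ler_poweR i2 _ _ hk.
  rewrite !in_itv/= !leey !poweR_ge0 lee_fin sqr_ge0 => /(_ isT isT).
  rewrite -poweRrM divff ?pnatr_eq0// poweRe1 ?Lnorm_ge0//.
  by rewrite /= powR12_sqrt ?sqr_ge0// sqrtr_sqr gtr0_norm.
apply/fine_cvgP; split.
  have := H 1 ltr01; apply: filterS => k hk.
  by rewrite ge0_fin_numE ?Lnorm_ge0// (le_lt_trans hk)// ltry.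
apply/cvgr0Pnorm_le => e e0; have := H e e0; apply: filterS => k hk.
have fk : Lnorm mu 2%:E (EFin \o h k) \is a fin_num.
  by rewrite ge0_fin_numE ?Lnorm_ge0// (le_lt_trans hk)// ltry.
by rewrite ger0_norm ?fine_ge0 ?Lnorm_ge0// -lee_fin fineK.
Qed.

Lemma measurable_sqrE f : measurable_fun setT f ->
  measurable_fun setT (fun x => (f x ^+ 2)%:E).
Proof. by move=> mf; apply/measurable_EFinP; exact: measurable_funX. Qed.

Lemma integral_sqrD_le f g : measurable_fun setT f -> measurable_fun setT g ->
  (\int[mu]_x ((f x + g x) ^+ 2)%:E <=
   2%:E * (\int[mu]_x (f x ^+ 2)%:E + \int[mu]_x (g x ^+ 2)%:E))%E.
Proof.
move=> mf mg.
rewrite -ge0_integralD//; [|by move=> x _; rewrite lee_fin sqr_ge0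
  |exact: measurable_sqrE|by move=> x _; rewrite lee_fin sqr_ge0
  |exact: measurable_sqrE].
rewrite -ge0_integralZl//; [|by apply: emeasurable_funD; exact: measurable_sqrE
  |by move=> x _; rewrite -EFinD lee_fin addr_ge0// sqr_ge0].
apply: ge0_integral_mono => x _; first by rewrite lee_fin sqr_ge0.
rewrite -EFinD -EFinM lee_fin -subr_ge0.
rewrite (_ : _ - _ = (f x - g x) ^+ 2) ?sqr_ge0//; ring.
Qed.

Lemma L2cvg0D h h' : (forall k, measurable_fun setT (h k)) ->
  (forall k, measurable_fun setT (h' k)) -> L2cvg0 h -> L2cvg0 h' ->
  L2cvg0 (fun k => h k \+ h' k).
Proof.
move=> mh mh' h0 h'0 e e0; have e4 : 0 < e / 4 by rewrite divr_gt0.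
have := h'0 _ e4; have := h0 _ e4; apply: filterS2 => k hk hk'.
apply: (le_trans (integral_sqrD_le (mh k) (mh' k))).
apply: (@le_trans _ _ (2%:E * ((e / 4)%:E + (e / 4)%:E))%E).
  by rewrite lee_pmul2l// leeD.
by rewrite -EFinD -EFinM lee_fin; lra.
Qed.

Lemma L2cvg0_le h h' : (forall k x, `|h k x| <= `|h' k x|) ->
  L2cvg0 h' -> L2cvg0 h.
Proof.
move=> hh' h'0 e /h'0; apply: filterS => k; apply: le_trans.
apply: ge0_integral_mono => x _; first by rewrite lee_fin sqr_ge0.
rewrite lee_fin -[leLHS]real_normK ?num_real// -[leRHS]real_normK ?num_real//.
by rewrite ler_sqr ?nnegrE.
Qed.

(** The part of g ^ 2 that lives where g is larger than m. *)
Definition sqr_tail g (m : nat) (x : T) : R :=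
  g x ^+ 2 * \1_[set x | m%:R < `|g x|] x.

Lemma measurable_sqr_tail g m : measurable_fun setT g ->
  measurable_fun setT (sqr_tail g m).
Proof.
move=> mg; apply: measurable_funM; first exact: measurable_funX.
apply: measurable_indic; rewrite -[X in measurable X]setTI.
apply: (measurable_fun_ltr _ _ measurableT) => //.
exact: measurableT_comp.
Qed.

Lemma sqr_tail_cvg0 g : measurable_fun setT g ->
  (\int[mu]_x (g x ^+ 2)%:E < +oo)%E ->
  (\int[mu]_x (sqr_tail g m x)%:E)%E @[m --> \oo] --> 0%E.
Proof.
move=> mg gi.
have ig : mu.-integrable setT (fun x => (g x ^+ 2)%:E).
  apply/integrableP; split; first exact: measurable_sqrE.
  by under eq_integral do rewrite gee0_abs ?lee_fin ?sqr_ge0//.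
have [|||||_ _] := @dominated_convergence _ _ _ mu setT measurableT
  (fun m x => (sqr_tail g m x)%:E) (cst 0%E) (fun x => (g x ^+ 2)%:E).
- by move=> m; apply/measurable_EFinP; exact: measurable_sqr_tail.
- exact: measurable_cst.
- apply: aeW => x _; apply: cvg_near_cst; exists (Num.truncn `|g x|).+1 => // m /= gm.
  rewrite /sqr_tail indicE memNset ?mulr0// => /=; apply/negP; rewrite -leNgt.
  by rewrite (le_trans (ltW (truncnS_gt _)))// ler_nat.
- exact: ig.
- apply: aeW => x m _; rewrite lee_fin /sqr_tail normrM ger0_norm ?sqr_ge0//.
  by rewrite ler_piMr ?sqr_ge0// indicE; case: (_ \in _); rewrite ?normr0 ?normr1.
by rewrite integral_cst// mul0e.
Qed.

(** A bounded sequence of multipliers dominated by a sequence that tends to 0 in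
    mean square sends a fixed square integrable g to a sequence that tends to 0.
    The truncation of g at height m splits h ^ 2 g ^ 2 into the tail of g ^ 2, small
    by dominated convergence, and at most (m L) ^ 2 r ^ 2; in this way no almost
    everywhere convergent subsequence has to be extracted. *)
Lemma L2cvg0_bounded_mul h (r : nat -> T -> R) g (L : R) :
  measurable_fun setT g -> (\int[mu]_x (g x ^+ 2)%:E < +oo)%E ->
  (forall k, measurable_fun setT (r k)) -> L2cvg0 r ->
  (forall k x, `|h k x| <= 1) -> (forall k x, `|h k x| <= L * `|r k x|) ->
  L2cvg0 (fun k => h k \* g).
Proof.
move=> mg gi mr r0 h1 hL e e0; have e20 : 0 < e / 2 by rewrite divr_gt0.
have [m mP] : exists m, (\int[mu]_x (sqr_tail g m x)%:E <= (e / 2)%:E)%E.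
  have /fine_cvgP[ft /cvgr0Pnorm_le /(_ _ e20) tl] := sqr_tail_cvg0 mg gi.
  have [m [fm tm]] := filter_ex (filterI ft tl); exists m.
  by rewrite -(fineK fm) lee_fin (le_trans (ler_norm _)).
pose K := (m%:R * L) ^+ 2.
have K0 : 0 <= K by exact: sqr_ge0.
have K1 : 0 < K + 1 by rewrite ltr_wpDl.
have e2K : 0 < e / 2 / (K + 1) by rewrite divr_gt0.
have := r0 _ e2K; apply: filterS => k rk.
apply: (@le_trans _ _ (\int[mu]_x ((sqr_tail g m x)%:E + K%:E * (r k x ^+ 2)%:E))%E).
  apply: ge0_integral_mono => x _ /=; first by rewrite lee_fin sqr_ge0.
  rewrite -EFinM -EFinD lee_fin /sqr_tail indicE.
  have h2 : h k x ^+ 2 <= 1.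
    by rewrite -real_normK ?num_real// -[leRHS](expr1n _ 2) lerXn2r ?nnegrE.
  have [gm|gm] := ltP m%:R `|g x|.
    rewrite mem_set//= mulr1 exprMn (@le_trans _ _ (g x ^+ 2))//.
      by rewrite ler_piMl ?sqr_ge0.
    by rewrite lerDl mulr_ge0 ?sqr_ge0.
  rewrite memNset/=; last by apply/negP; rewrite -leNgt.
  rewrite mulr0 add0r /K -exprMn.
  rewrite -[leLHS]real_normK ?num_real// -[leRHS]real_normK ?num_real//.
  rewrite lerXn2r ?nnegrE// !normrM mulrC -mulrA ler_pM//.
    by rewrite (le_trans gm)// ler_norm.
  rewrite (le_trans (hL k x))// ler_wpM2r//; exact: ler_norm.
rewrite ge0_integralD//; last 4 first.
- by move=> x _; rewrite lee_fin /sqr_tail mulr_ge0 ?sqr_ge0// indicE.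
- by apply/measurable_EFinP; exact: measurable_sqr_tail.
- by move=> x _; rewrite -EFinM lee_fin mulr_ge0 ?sqr_ge0.
- by apply: measurable_funeM; exact: measurable_sqrE.
rewrite ge0_integralZl//; last 2 first.
- exact: measurable_sqrE.
- by move=> x _; rewrite lee_fin sqr_ge0.
apply: (@le_trans _ _ ((e / 2)%:E + K%:E * (e / 2 / (K + 1))%:E)%E).
  by rewrite leeD// lee_wpmul2l.
rewrite -EFinM -EFinD lee_fin [leRHS](splitr e) lerD2l.
rewrite mulrA ler_pdivrMr// mulrC ler_wpM2l ?ltW//.
by rewrite ltrDl.
Qed.

End square_integrable.

(** * Integration by parts in the closure of the test functions *)

(** Young's inequality, which replaces the Cauchy-Schwarz inequality on sets of
    finite measure: delta is chosen small and then the square is made small. *)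
Lemma norm_le_sqr (R : realFieldType) (a delta : R) : 0 < delta ->
  `|a| <= delta + delta^-1 * a ^+ 2.
Proof.
move=> d0; rewrite -(@real_normK _ a) ?num_real//; set t := `|a|.
rewrite -subr_ge0 (_ : _ - _ =
   delta^-1 * ((delta - t) ^+ 2 / 2 + (delta ^+ 2 + t ^+ 2) / 2)); last first.
  by field; rewrite gt_eqF.
by rewrite mulr_ge0 ?invr_ge0 ?(ltW d0)// addr_ge0// divr_ge0 ?addr_ge0 ?sqr_ge0.
Qed.

Section H10_theory.
Context {R : realType} {N : nat} (Omega : set 'rV[R]_N).
Hypotheses (oOmega : open Omega) (bOmega : bounded_set Omega).
Local Notation leb := (@lebesgue_rV R N).
Implicit Types (a b alpha u phi : 'rV[R]_N -> R) (G : 'rV[R]_N -> 'rV[R]_N).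

Let mOmega : measurable Omega. Proof. exact: open_measurable_rV. Qed.

Let vol : R := fine (leb Omega).

Let vol_ge0 : 0 <= vol. Proof. by rewrite fine_ge0. Qed.

Let volE : leb Omega = vol%:E.
Proof.
by rewrite fineK// ge0_fin_numE//; exact: bounded_lebesgue_rV_lty.
Qed.

(** The free parameter delta lets the bound become arbitrarily small together with
    the mean square q of a. *)
Lemma mul_bounded_L2 a alpha (C delta q : R) :
  measurable_fun setT a -> measurable_fun setT alpha ->
  (forall x, ~ Omega x -> a x = 0) ->
  {ae leb, forall x, Omega x -> `|alpha x| <= C} ->
  0 <= C -> 0 < delta -> (\int[leb]_x (a x ^+ 2)%:E <= q%:E)%E ->
  leb.-integrable setT (fun x => (a x * alpha x)%:E) /\
  (\int[leb]_x `|(a x * alpha x)%:E| <= (C * (delta * vol + delta^-1 * q))%:E)%E.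
Proof.
move=> ma malpha a0 alphaC C0 delta0 aq.
have H : (\int[leb]_x `|(a x * alpha x)%:E| <=
    (C * (delta * vol + delta^-1 * q))%:E)%E.
  apply: (@le_trans _ _ (\int[leb]_x ((C * delta)%:E * (\1_Omega x)%:E +
      (C * delta^-1)%:E * (a x ^+ 2)%:E))%E).
    apply: ae_ge0_le_integral => //.
    - apply: measurableT_comp => //; apply/measurable_EFinP.
      exact: measurable_funM.
    - move=> x _; rewrite -!EFinM -EFinD lee_fin indicE addr_ge0//.
        by rewrite mulr_ge0// mulr_ge0// ltW.
      by rewrite mulr_ge0 ?sqr_ge0// mulr_ge0// invr_ge0 ltW.
    - apply: emeasurable_funD; apply: measurable_funeM; last exact: measurable_sqrE.
      by apply/measurable_EFinP; exact: measurable_indic.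
    move: alphaC; apply: filterS => x alphaC _.
    rewrite -!EFinM -EFinD lee_fin indicE.
    have [Ox|nOx] := pselect (Omega x); last first.
      by rewrite memNset// a0// mul0r normr0 mulr0 add0r expr0n mulr0.
    rewrite mem_set//= mulr1 normrM -mulrA -mulrDr mulrC ler_pM//; first exact: alphaC.
    exact: norm_le_sqr.
  rewrite ge0_integralD//; last 4 first.
  - by move=> x _; rewrite -EFinM lee_fin mulr_ge0// mulr_ge0// ltW.
  - by apply: measurable_funeM; apply/measurable_EFinP; exact: measurable_indic.
  - move=> x _; rewrite -EFinM lee_fin mulr_ge0 ?sqr_ge0// mulr_ge0//.
    by rewrite invr_ge0 ltW.
  - by apply: measurable_funeM; exact: measurable_sqrE.
  have Cd0 : 0 <= C * delta by rewrite mulr_ge0// ltW.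
  have Cd'0 : 0 <= C * delta^-1 by rewrite mulr_ge0// invr_ge0 ltW.
  have -> : (\int[leb]_x ((C * delta)%:E * (\1_Omega x)%:E) = (C * delta * vol)%:E)%E.
    rewrite ge0_integralZl_EFin//.
    - by rewrite integral_indic// setIT [X in (_ * X)%E]volE.
    - by apply/measurable_EFinP; exact: measurable_indic.
  have -> : (\int[leb]_x ((C * delta^-1)%:E * (a x ^+ 2)%:E) =
      (C * delta^-1)%:E * \int[leb]_x (a x ^+ 2)%:E)%E.
    rewrite ge0_integralZl_EFin//.
    - by move=> x _; rewrite lee_fin sqr_ge0.
    - exact: measurable_sqrE.
  by rewrite mulrDr EFinD !mulrA leeD// [leRHS]EFinM lee_wpmul2l.
split => //; apply/integrableP; split.
  by apply/measurable_EFinP; exact: measurable_funM.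
by rewrite (le_lt_trans H)// ltry.
Qed.

(** The approximation clause of H10 with the norms replaced by integrals of
    squares. *)
Definition approximates (phi_ : nat -> 'rV[R]_N -> R) u G :=
  [/\ forall k : nat, test_function Omega (phi_ k),
      L2cvg0 leb (fun k => phi_ k \- u) &
      forall i, L2cvg0 leb (fun k x => partial i (phi_ k) x - G x ord0 i)].

(** The identity holds for the test functions of the approximating sequence, and
    both sides are continuous for the mean-square convergence because eta and its
    derivative are bounded on Omega, which has finite measure. *)
Lemma approximates_by_parts (phi_ : nat -> 'rV[R]_N -> R) u G (eta : 'rV[R]_N -> R) i :
  Lebesgue_space Omega 2 u -> Lebesgue_space Omega 2 (fun x => G x ord0 i) ->
  approximates phi_ u G ->
  (forall x, differentiable eta x) -> continuous (partial i eta) ->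
  (exists C : R, forall x, Omega x -> `|eta x| <= C) ->
  (exists C : R, forall x, Omega x -> `|partial i eta x| <= C) ->
  [/\ leb.-integrable setT (fun x => (u x * partial i eta x)%:E),
      leb.-integrable setT (fun x => (G x ord0 i * eta x)%:E) &
      (\int[leb]_x (u x * partial i eta x)%:E +
       \int[leb]_x (G x ord0 i * eta x)%:E = 0)%E].
Proof.
move=> [/Lfun2P[mu ui] u0] [/Lfun2P[mG Gi] G0] [tphi cphi cdphi] deta ceta bet bdet.
have [C [C0 C1P C2P]] : exists C : R, [/\ 0 <= C,
    forall x, Omega x -> `|eta x| <= C &
    forall x, Omega x -> `|partial i eta x| <= C].
  have [C1 H1] := bet; have [C2 H2] := bdet; exists (`|C1| + `|C2|); split.
  - by rewrite addr_ge0.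
  - by move=> x /H1/le_trans; apply; rewrite (le_trans (ler_norm _))// lerDl.
  - by move=> x /H2/le_trans; apply; rewrite (le_trans (ler_norm _))// lerDr.
have meta : measurable_fun setT eta.
  by apply: continuous_measurable_rV => x; exact: differentiable_continuous.
have mdeta : measurable_fun setT (partial i eta) by exact: continuous_measurable_rV.
have fu : (\int[leb]_x (u x ^+ 2)%:E <= (fine (\int[leb]_x (u x ^+ 2)%:E))%:E)%E.
  by rewrite fineK// ge0_fin_numE// integral_ge0// => x _; rewrite lee_fin sqr_ge0.
have fG : (\int[leb]_x (G x ord0 i ^+ 2)%:E <=
    (fine (\int[leb]_x (G x ord0 i ^+ 2)%:E))%:E)%E.
  by rewrite fineK// ge0_fin_numE// integral_ge0// => x _; rewrite lee_fin sqr_ge0.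
have [iu _] := mul_bounded_L2 mu mdeta u0 (aeW leb C2P) C0 ltr01 fu.
have [iG _] := mul_bounded_L2 mG meta G0 (aeW leb C1P) C0 ltr01 fG.
split => //.
have iF := integrableD measurableT iu iG.
rewrite -integralD//; set A := (\int[leb]_x _)%E.
have fA : A \is a fin_num by exact: integrable_fin_num.
suff AE e : 0 < e -> (`|A| <= e%:E)%E.
  apply/eqP; rewrite -abse_eq0 eq_le abse_ge0 andbT.
  by apply/lee_addgt0Pr => e /AE; rewrite add0e.
move=> e0.
(* delta makes the term C delta vol at most e / 4; then q, the mean-square error of
   the approximation, makes C q / delta at most e / 4. *)
pose delta := e / 4 / (C + 1) / (vol + 1).
have C10 : 0 < C + 1 by rewrite ltr_wpDl.
have v10 : 0 < vol + 1 by rewrite ltr_wpDl.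
have delta0 : 0 < delta by rewrite !divr_gt0.
pose q := e / 4 / (C + 1) * delta.
have q0 : 0 < q by rewrite mulr_gt0// !divr_gt0.
have [k [ck dk]] := filter_ex (filterI (cphi _ q0) (cdphi i _ q0)).
have [sphi _ _] := tphi k.
have mphi := smooth_measurable sphi.
have mdphi := smooth_measurable (smooth_partial i sphi).
have out x : ~ Omega x -> phi_ k x = 0 /\ partial i (phi_ k) x = 0.
  by move=> nOx; have [? ?] := test_function_out (tphi k) nOx.
have bnd : C * (delta * vol + delta^-1 * q) <= e / 2.
  rewrite /q mulrCA mulVf ?gt_eqF// mulr1.
  have dv : delta * vol <= e / 4 / (C + 1).
    by rewrite /delta -mulrA ler_piMr ?divr_ge0 ?(ltW e0) ?(ltW C10)// mulrC
      ler_pdivrMr// mul1r lerDl.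
  apply: (@le_trans _ _ (C * (e / 4 / (C + 1) + e / 4 / (C + 1)))).
    by rewrite ler_wpM2l// lerD2r.
  rewrite (_ : _ * _ = C / (C + 1) * (e / 2)); last by field; rewrite gt_eqF.
  by rewrite ler_piMl ?divr_ge0 ?(ltW e0)// ler_pdivrMr// mul1r lerDl.
have [i1 b1] : leb.-integrable setT (fun x => ((phi_ k \- u) x * partial i eta x)%:E) /\
    (\int[leb]_x `|((phi_ k \- u) x * partial i eta x)%:E| <= (e / 2)%:E)%E.
  have [|x nOx|? H] := mul_bounded_L2 (a := phi_ k \- u) _ mdeta _
      (aeW leb C2P) C0 delta0 ck.
  - exact: measurable_funB.
  - by rewrite /= u0// (out x nOx).1 subrr.
  - by split => //; rewrite (le_trans H)// lee_fin.
have [i2 b2] : leb.-integrable setT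
      (fun x => ((partial i (phi_ k) x - G x ord0 i) * eta x)%:E) /\
    (\int[leb]_x `|((partial i (phi_ k) x - G x ord0 i) * eta x)%:E| <= (e / 2)%:E)%E.
  have [|x nOx|? H] := mul_bounded_L2 (a := fun x => partial i (phi_ k) x - G x ord0 i)
      _ meta _ (aeW leb C1P) C0 delta0 dk.
  - exact: measurable_funB.
  - by rewrite /= G0// (out x nOx).2 subrr.
  - by split => //; rewrite (le_trans H)// lee_fin.
have iD := integrableD measurableT i1 i2.
have := test_function_by_parts bOmega (tphi k) deta ceta bet bdet.
rewrite (_ : (fun x => _) =
  (fun x => (u x * partial i eta x)%:E + (G x ord0 i * eta x)%:E) \+
  (fun x => ((phi_ k \- u) x * partial i eta x)%:E +
            ((partial i (phi_ k) x - G x ord0 i) * eta x)%:E))%E; last first.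
  by apply/funext => x /=; rewrite -!EFinD; congr EFin; ring.
have fD := integrable_fin_num measurableT iD.
rewrite integralD// -/A -(fineK fA) -(fineK fD) -EFinD => -[/eqP].
rewrite addr_eq0 => /eqP ->; rewrite EFinN abseN fineK// integralD//.
rewrite (le_trans (lee_abs_add _ _))// [e]splitr EFinD leeD//.
- by rewrite (le_trans _ b1)// le_abse_integral//; exact: measurable_int i1.
- by rewrite (le_trans _ b2)// le_abse_integral//; exact: measurable_int i2.
Qed.

End H10_theory.

(** * Differences and softplus truncations in H10 *)

Section H10_constructions.
Context {R : realType} {N : nat} (Omega : set 'rV[R]_N).
Hypotheses (oOmega : open Omega) (bOmega : bounded_set Omega).
Local Notation leb := (@lebesgue_rV R N).
Implicit Types (u v phi : 'rV[R]_N -> R) (G : 'rV[R]_N -> 'rV[R]_N).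

Lemma integral_support (F : 'rV[R]_N -> \bar R) :
  (forall x, ~ Omega x -> F x = 0%E) ->
  (\int[leb]_(x in Omega) F x = \int[leb]_x F x)%E.
Proof.
move=> F0; rewrite integral_mkcond; apply: eq_integral => x _.
by rewrite patchE; case: ifPn => //; rewrite notin_setE => /F0.
Qed.

Lemma H10_approximates u G : H10 Omega u G ->
  exists phi_ : nat -> 'rV[R]_N -> R, approximates Omega phi_ u G.
Proof.
move=> [_ [phi_ [tphi cphi cdphi]]]; exists phi_; split => //.
- exact/Lnorm2_cvg0P.
- by move=> i; apply/Lnorm2_cvg0P; exact: cdphi.
Qed.

(** The weak gradient comes for free from the approximation, by integration by
    parts against a test function eta. *)
Lemma approximates_H10 (phi_ : nat -> 'rV[R]_N -> R) u G :
  Lebesgue_space Omega 2 u ->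
  (forall i, Lebesgue_space Omega 2 (fun x => G x ord0 i)) ->
  approximates Omega phi_ u G -> H10 Omega u G.
Proof.
move=> Lu LG au; have [tphi cphi cdphi] := au; split.
  split => // eta teta i; have [seta _ _] := teta.
  have bnd f : test_function Omega f ->
      exists C : R, forall x, Omega x -> `|f x| <= C.
    by move=> /test_function_bounded[C CP]; exists C.
  have [i1 i2] := @approximates_by_parts _ _ _ oOmega bOmega phi_ u G eta i Lu (LG i) au
    (fun x => smooth_differentiable x seta)
    (smooth_continuous (smooth_partial i seta))
    (bnd _ teta) (bnd _ (test_function_partial i teta)).
  have f1 := integrable_fin_num measurableT i1.
  have f2 := integrable_fin_num measurableT i2.
  rewrite /Rintegral !integral_support; last 2 first.
  - by move=> x nOx; rewrite (LG i).2// mul0r.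
  - by move=> x nOx; rewrite Lu.2// mul0r.
  rewrite -(fineK f1) -(fineK f2) -EFinD => -[/eqP]; rewrite addr_eq0 => /eqP.
  by rewrite !fineK.
exists phi_; split => //.
- exact/Lnorm2_cvg0P.
- move=> i.
  by apply/(@Lnorm2_cvg0P _ _ _ leb (fun k x => partial i (phi_ k) x - G x ord0 i)).
Qed.

Lemma Lebesgue_space2P u : Lebesgue_space Omega 2 u <->
  [/\ measurable_fun setT u, (\int[leb]_x (u x ^+ 2)%:E < +oo)%E &
      forall x, ~ Omega x -> u x = 0].
Proof.
by split=> [[/Lfun2P[? ?] ?]|[? ? ?]]; split => //; apply/Lfun2P.
Qed.

Lemma Lebesgue_space2B u v : Lebesgue_space Omega 2 u ->
  Lebesgue_space Omega 2 v -> Lebesgue_space Omega 2 (fun x => u x - v x).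
Proof.
move=> /Lebesgue_space2P[mu ui u0] /Lebesgue_space2P[mv vi v0].
apply/Lebesgue_space2P; split.
- exact: measurable_funB.
- have mNv : measurable_fun setT (fun x => - v x) by exact: measurableT_comp.
  apply: (le_lt_trans (integral_sqrD_le leb mu mNv)).
  rewrite lte_mul_pinfty// lte_add_pinfty//.
  by under eq_integral do rewrite sqrrN.
- by move=> x nOx; rewrite u0// v0// subrr.
Qed.

Lemma Lebesgue_space2_le u v : measurable_fun setT v ->
  (forall x, `|v x| <= `|u x|) -> Lebesgue_space Omega 2 u ->
  Lebesgue_space Omega 2 v.
Proof.
move=> mv vu /Lebesgue_space2P[mu ui u0]; apply/Lebesgue_space2P; split => //.
- apply: le_lt_trans ui; apply: ge0_integral_mono => x _.
    by rewrite lee_fin sqr_ge0.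
  rewrite lee_fin -[leLHS]real_normK ?num_real// -[leRHS]real_normK ?num_real//.
  by rewrite lerXn2r ?nnegrE.
- by move=> x /u0 ux; apply/eqP; rewrite -normr_le0 (le_trans (vu x))// ux normr0.
Qed.

Lemma H10B u v Gu Gv : H10 Omega u Gu -> H10 Omega v Gv ->
  H10 Omega (u \- v) (fun x => Gu x - Gv x).
Proof.
move=> Hu Hv; have [phi_ [tphi cphi cdphi]] := H10_approximates Hu.
have [psi_ [tpsi cpsi cdpsi]] := H10_approximates Hv.
have [[Lu LGu _] _] := Hu; have [[Lv LGv _] _] := Hv.
have /Lebesgue_space2P[mu _ _] := Lu; have /Lebesgue_space2P[mv _ _] := Lv.
have mGu i : measurable_fun setT (fun x => Gu x ord0 i).
  by have /Lebesgue_space2P[] := LGu i.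
have mGv i : measurable_fun setT (fun x => Gv x ord0 i).
  by have /Lebesgue_space2P[] := LGv i.
have sphi k : smooth (phi_ k) by have [] := tphi k.
have spsi k : smooth (psi_ k) by have [] := tpsi k.
apply: (@approximates_H10 (fun k => phi_ k \- psi_ k)).
- exact: Lebesgue_space2B.
- move=> i; rewrite (_ : (fun x => _) = (fun x => Gu x ord0 i - Gv x ord0 i)).
    exact: Lebesgue_space2B.
  by apply/funext => x; rewrite !mxE.
split.
- by move=> k; exact: test_functionB.
- rewrite (_ : (fun k => _) = (fun k => (phi_ k \- u) \+ (v \- psi_ k))); last first.
    by apply/funext => k; apply/funext => x /=; ring.
  apply: L2cvg0D => //.
  + by move=> k; apply: measurable_funB => //; exact: smooth_measurable.
  + by move=> k; apply: measurable_funB => //; exact: smooth_measurable.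
  + by apply: L2cvg0_le cpsi => k x /=; rewrite distrC.
- move=> i.
  rewrite (_ : (fun k => _) = (fun k =>
     (fun x => partial i (phi_ k) x - Gu x ord0 i) \+
     (fun x => Gv x ord0 i - partial i (psi_ k) x))); last first.
    apply/funext => k; apply/funext => x /=; rewrite partialB.
    + by rewrite !mxE /=; ring.
    + by move=> y; exact: smooth_differentiable.
    + by move=> y; exact: smooth_differentiable.
  apply: L2cvg0D => //.
  + move=> k; apply: measurable_funB => //; apply: smooth_measurable.
    exact: smooth_partial.
  + move=> k; apply: measurable_funB => //; apply: smooth_measurable.
    exact: smooth_partial.
  + by apply: L2cvg0_le (cdpsi i) => k x /=; rewrite distrC.
Qed.

Lemma measurable_softplus (e : R) : 0 < e -> measurable_fun setT (softplus e).
Proof.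
move=> e0; apply: continuous_measurable_fun => t.
apply/differentiable_continuous/derivable1_diffP.
by have [] := is_derive_softplus t e0.
Qed.

Lemma measurable_logistic (e : R) : 0 < e -> measurable_fun setT (logistic e).
Proof.
move=> e0; apply: continuous_measurable_fun => t.
apply/differentiable_continuous/derivable1_diffP.
by have [] := is_derive_logistic t e0.
Qed.

(** Chain rule.  If test functions phi_k approximate u, then the test functions
    softplus \o phi_k approximate softplus \o u because softplus is 1-Lipschitz.
    For the gradients, logistic (phi_k) D phi_k - logistic (u) G splits into
    logistic (phi_k) (D phi_k - G), where the multiplier is at most 1, and
    (logistic (phi_k) - logistic (u)) G, treated by [L2cvg0_bounded_mul]. *)
Lemma H10_softplus (e : R) u G : 0 < e -> H10 Omega u G ->
  H10 Omega (softplus e \o u) (fun x => logistic e (u x) *: G x).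
Proof.
move=> e0 Hu; have [phi_ [tphi cphi cdphi]] := H10_approximates Hu.
have [[Lu LG _] _] := Hu.
have /Lebesgue_space2P[mu _ _] := Lu.
have mG i : measurable_fun setT (fun x => G x ord0 i).
  by have /Lebesgue_space2P[] := LG i.
have sphi k : smooth (phi_ k) by have [] := tphi k.
have mphi k := smooth_measurable (sphi k).
have mdphi k i := smooth_measurable (smooth_partial i (sphi k)).
have ml (f : 'rV[R]_N -> R) : measurable_fun setT f ->
    measurable_fun setT (logistic e \o f).
  by move=> mf; apply: measurableT_comp mf; exact: measurable_logistic.
have l1 t : `|logistic e t| <= 1 by rewrite ger0_norm ?logistic_ge0 ?logistic_le1.
apply: (@approximates_H10 (fun k => softplus e \o phi_ k)).
- apply: Lebesgue_space2_le Lu.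
    by apply: measurableT_comp => //; exact: measurable_softplus.
  by move=> x /=; have := softplus_lipschitz (u x) 0 e0; rewrite softplus0 !subr0.
- move=> i; apply: Lebesgue_space2_le (LG i).
    under eq_fun do rewrite mxE.
    by apply: measurable_funM => //; exact: ml.
  by move=> x; rewrite mxE normrM ler_piMl.
split.
- by move=> k; exact: test_function_softplus.
- by apply: L2cvg0_le cphi => k x /=; exact: softplus_lipschitz.
- move=> i.
  rewrite (_ : (fun k => _) = (fun k =>
     (fun x => logistic e (phi_ k x) * (partial i (phi_ k) x - G x ord0 i)) \+
     ((fun x => logistic e (phi_ k x) - logistic e (u x)) \*
      (fun x => G x ord0 i)))); last first.
    apply/funext => k; apply/funext => x /=; rewrite partial_softplus//= mxE; ring.
  apply: L2cvg0D => //.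
  + move=> k; apply: measurable_funM; first exact: ml.
    exact: measurable_funB.
  + move=> k; apply: measurable_funM => //.
    by apply: measurable_funB; exact: ml.
  + by apply: L2cvg0_le (cdphi i) => k x /=; rewrite normrM ler_piMl.
  + have /Lebesgue_space2P[_ Gi _] := LG i.
    apply: (@L2cvg0_bounded_mul _ _ _ _ _ (fun k => phi_ k \- u) _ e^-1) => //.
    * by move=> k; exact: measurable_funB.
    * move=> k x; rewrite ler_norml; apply/andP.
      have := logistic_ge0 e (phi_ k x); have := logistic_le1 e (phi_ k x).
      have := logistic_ge0 e (u x); have := logistic_le1 e (u x); lra.
    * by move=> k x; exact: logistic_lipschitz.
Qed.

End H10_constructions.

(** * The energy estimate *)

(** The terms a and b may be infinite a priori; the equations force them to be
    finite. *)
Lemma leeB_of_addE (R : realDomainType) (l1 l2 r1 r2 a b : \bar R) :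
  (l1 \is a fin_num -> l2 \is a fin_num -> r1 \is a fin_num -> r2 \is a fin_num ->
   l1 + a = r1 -> l2 + b = r2 -> b <= a -> l1 - l2 <= r1 - r2)%E.
Proof.
case: l1 l2 r1 r2 => [l1| |] [l2| |] [r1| |] [r2| |] // _ _ _ _.
case: a b => [a| |] [b| |] // [<-] [<-]; rewrite !lee_fin => ba.
by rewrite opprD addrACA lerDl subr_ge0.
Qed.

Section comparison.
Context {R : realType} {N : nat} (Omega : set 'rV[R]_N).
Hypotheses (oOmega : open Omega) (bOmega : bounded_set Omega).
Local Notation leb := (@lebesgue_rV R N).
Local Notation vol := (fine (leb Omega)).
Implicit Types (f g u v h psi : 'rV[R]_N -> R) (G H : 'rV[R]_N -> 'rV[R]_N).

Lemma frac_const_ge0 (s : R) : 0 <= @frac_const R N s.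
Proof.
rewrite invr_ge0; apply: Rintegral_ge0 => x _.
by rewrite divr_ge0 ?powR_ge0// subr_ge0 cos_le1.
Qed.

Lemma integral_cst_indic (C : R) : 0 <= C ->
  leb.-integrable setT (fun x => (C * \1_Omega x)%:E) /\
  (\int[leb]_x (C * \1_Omega x)%:E = (C * vol)%:E)%E.
Proof.
move=> C0; have mO : measurable Omega by exact: open_measurable_rV.
have volE : leb Omega = vol%:E.
  by rewrite fineK// ge0_fin_numE//; exact: bounded_lebesgue_rV_lty.
have IE : (\int[leb]_x (C * \1_Omega x)%:E = (C * vol)%:E)%E.
  under eq_integral do rewrite EFinM.
  rewrite ge0_integralZl_EFin//.
  - by rewrite integral_indic// setIT [X in (_ * X)%E]volE.
  - by apply/measurable_EFinP; exact: measurable_indic.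
split => //; apply/integrableP; split.
  apply/measurable_EFinP; apply: measurable_funM; first exact: measurable_cst.
  exact: measurable_indic.
under eq_integral do rewrite gee0_abs ?lee_fin ?mulr_ge0//.
by rewrite IE ltry.
Qed.

Lemma dotp_integrable G H :
  (forall i, Lebesgue_space Omega 2 (fun x => G x ord0 i)) ->
  (forall i, Lebesgue_space Omega 2 (fun x => H x ord0 i)) ->
  leb.-integrable setT (fun x => (dotp (G x) (H x))%:E).
Proof.
move=> LG LH; rewrite (_ : (fun x => _) =
    (fun x => \sum_(i < N) (G x ord0 i * H x ord0 i)%:E)%E); last first.
  by apply/funext => x; rewrite sumEFin.
apply: integrable_sum => // i _.
have := Lfun2_mul_Lfun1 (LG i).1 (LH i).1.
by move/Lfun1_integrable.
Qed.

(** The right-hand side of the regularized equation, as a multiplier of the test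
    function.  For h >= 0 and u > 0 it is bounded by a constant that depends on n and
    gamma only, nondecreasing in h and nonincreasing in u. *)
Definition singular_coef (gamma : R) h (n : nat) u : 'rV[R]_N -> R :=
  fun x => Num.min (h x) n%:R / (u x + n%:R^-1) `^ gamma.

Lemma singular_coef_bound (gamma : R) h n u x : 0 <= gamma -> (0 < n)%N ->
  0 <= h x -> 0 < u x ->
  0 <= singular_coef gamma h n u x <= n%:R * (n%:R^-1 `^ gamma)^-1.
Proof.
move=> g0 n0 h0 u0; have n0' : 0 < n%:R^-1 :> R by rewrite invr_gt0 ltr0n.
have m0 : 0 <= Num.min (h x) n%:R by rewrite le_min h0 ler0n.
apply/andP; split; first by rewrite divr_ge0 ?powR_ge0.
rewrite ler_pM ?invr_ge0 ?powR_ge0// ?ge_min ?lexx ?orbT//.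
rewrite lef_pV2 ?posrE ?powR_gt0 ?addr_gt0//.
by rewrite ge0_ler_powR// ?nnegrE ?addr_ge0 ?(ltW n0') ?(ltW u0)// lerDr ltW.
Qed.

Lemma singular_coef_le (gamma : R) f g n u v x : 0 <= gamma -> (0 < n)%N ->
  0 <= f x <= g x -> 0 < v x <= u x ->
  singular_coef gamma f n u x <= singular_coef gamma g n v x.
Proof.
move=> g0 n0 /andP[f0 fg] /andP[v0 vu].
have n0' : 0 < n%:R^-1 :> R by rewrite invr_gt0 ltr0n.
have u0 := lt_le_trans v0 vu.
rewrite ler_pM ?invr_ge0 ?powR_ge0//.
- by rewrite le_min f0 ler0n.
- by rewrite le_min !ge_min fg lexx orbT.
rewrite lef_pV2 ?posrE ?powR_gt0 ?addr_gt0//.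
by rewrite ge0_ler_powR// ?nnegrE ?addr_ge0 ?(ltW n0') ?(ltW u0) ?(ltW v0)// lerD2r.
Qed.

Lemma measurable_singular_coef (gamma : R) h n u : measurable_fun setT h ->
  measurable_fun setT u -> measurable_fun setT (singular_coef gamma h n u).
Proof.
move=> mh mu; rewrite /singular_coef.
under eq_fun do rewrite -powRN.
apply: measurable_funM; first exact: measurable_minr.
apply: (measurableT_comp (measurable_powR (- gamma))).
exact: measurable_funD.
Qed.

(** Where u > v the difference of the coefficients is nonpositive, so that its
    product with the positive part of u - v is nonpositive; the error committed in
    replacing the positive part by the softplus is at most e times the bound of the
    coefficients. *)
Lemma singular_coef_softplus_le (gamma : R) f g n u v x (e : R) :
  0 <= gamma -> (0 < n)%N -> 0 < e -> 0 <= f x <= g x -> 0 < u x -> 0 < v x ->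
  softplus e (u x - v x) *
    (singular_coef gamma f n u x - singular_coef gamma g n v x) <=
  n%:R * (n%:R^-1 `^ gamma)^-1 * e.
Proof.
move=> g0 n0 e0 /andP[f0 fg] u0 v0.
have /andP[a0 aK] := singular_coef_bound g0 n0 f0 u0.
have /andP[b0 bK] := singular_coef_bound g0 n0 (le_trans f0 fg) v0.
have /andP[P1 P2] := softplus_near (u x - v x) e0.
set K := n%:R * _ in aK bK *; set a := singular_coef _ f _ _ _ in a0 aK *.
set b := singular_coef _ g _ _ _ in b0 bK *; set P := softplus _ _ in P1 P2 *.
have K0 : 0 <= K := le_trans a0 aK.
have Pe : - e <= P by apply: le_trans P1; rewrite lerBrDl subrr le_max lexx.
have DK : `|a - b| <= K by rewrite ler_norml; apply/andP; split; lra.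
have [P0|P0] := leP P 0.
  apply: (le_trans (ler_norm _)); rewrite normrM mulrC ler_pM//.
  by rewrite ler0_norm// lerNl.
have uv : v x <= u x.
  rewrite leNgt; apply/negP => uv.
  have M0 : Num.max 0 (u x - v x) = 0 by apply: max_l; rewrite subr_le0 ltW.
  by move: P0; rewrite ltNge; rewrite M0 in P2; rewrite P2.
have ab : a <= b by apply: singular_coef_le => //; rewrite ?f0 ?v0.
apply: (@le_trans _ _ 0); last by rewrite mulr_ge0// ltW.
by rewrite mulr_ge0_le0 ?(ltW P0)// subr_le0.
Qed.

(** The right-hand side is sigma |a - b| ^ 2, and sigma ^ 2 <= sigma. *)
Lemma dotp_scale_ge (sigma : R) (a b : 'rV[R]_N) i : 0 <= sigma <= 1 ->
  (sigma * (a ord0 i - b ord0 i)) ^+ 2 <=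
  dotp a (sigma *: (a - b)) - dotp b (sigma *: (a - b)).
Proof.
move=> /andP[s0 s1]; rewrite /dotp -sumrB (bigD1 i)//=.
have E j : a ord0 j * (sigma *: (a - b)) ord0 j - b ord0 j * (sigma *: (a - b)) ord0 j
    = sigma * (a ord0 j - b ord0 j) ^+ 2 by rewrite !mxE; ring.
rewrite E -[leLHS]addr0 lerD//; last first.
  by apply: sumr_ge0 => j _; rewrite E mulr_ge0// sqr_ge0.
by rewrite exprMn ler_wpM2r ?sqr_ge0// expr2 ler_piMl.
Qed.

Definition nonlocal_form (s : R) u psi : \bar R :=
  (\int[leb \x leb]_z ((u z.1 - u z.2) * (psi z.1 - psi z.2) /
     enorm (z.1 - z.2) `^ (N%:R + 2 * s))%:E)%E.

Lemma regularized_weak_formT (s gamma : R) h n u Gu psi Gpsi :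
  regularized_weak_form Omega s gamma h n u Gu -> H10 Omega psi Gpsi ->
  (\int[leb]_x (dotp (Gu x) (Gpsi x))%:E +
   (@frac_const R N s / 2)%:E * nonlocal_form s u psi =
   \int[leb]_x (psi x * singular_coef gamma h n u x)%:E)%E.
Proof.
move=> WF Hpsi; have [[Lpsi LGpsi _] _] := Hpsi.
have E1 : (\int[leb]_(x in Omega) (dotp (Gu x) (Gpsi x))%:E =
    \int[leb]_x (dotp (Gu x) (Gpsi x))%:E)%E.
  apply: integral_support => x nOx; rewrite /dotp big1// => j _.
  by rewrite (LGpsi j).2// mulr0.
have E2 : (\int[leb]_(x in Omega)
      (Num.min (h x) n%:R * psi x / (u x + n%:R^-1) `^ gamma)%:E =
    \int[leb]_x (psi x * singular_coef gamma h n u x)%:E)%E.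
  rewrite integral_support; last by move=> x nOx; rewrite Lpsi.2// mulr0 mul0r.
  by apply: eq_integral => x _; congr EFin; rewrite /singular_coef; ring.
by have := WF _ _ Hpsi; rewrite E1 E2.
Qed.

(** Both equations are tested with psi = softplus (u - v) and subtracted.  Softplus
    being nondecreasing, the integrand of the nonlocal term of u dominates that of v
    pointwise, so the difference of the nonlocal terms is nonnegative and is
    dropped.  There remains the integral of logistic (u - v) |Gu - Gv| ^ 2, which
    dominates the square of each component of the gradient of psi and is at most the
    difference of the right-hand sides, of order e. *)
Lemma energy_estimate (s gamma : R) f g n u v Gu Gv (e : R) (i : 'I_N) :
  0 <= gamma -> (0 < n)%N -> 0 < e ->
  measurable_fun setT f -> measurable_fun setT g ->
  {ae leb, forall x, Omega x -> 0 <= f x <= g x} ->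
  {ae leb, forall x, Omega x -> 0 < u x} ->
  {ae leb, forall x, Omega x -> 0 < v x} ->
  H10 Omega u Gu -> H10 Omega v Gv ->
  regularized_weak_form Omega s gamma f n u Gu ->
  regularized_weak_form Omega s gamma g n v Gv ->
  (\int[leb]_x ((logistic e (u x - v x) * (Gu x ord0 i - Gv x ord0 i)) ^+ 2)%:E <=
    (n%:R * (n%:R^-1 `^ gamma)^-1 * (e * vol))%:E)%E.
Proof.
move=> gamma0 n0 e0 mf mg fg u0 v0 Hu Hv WFu WFv.
have Hpsi := H10_softplus oOmega bOmega e0 (H10B oOmega bOmega Hu Hv).
set psi := _ \o _ in Hpsi; set Gpsi := (fun x => _) in Hpsi.
set K := n%:R * _.
have K0 : 0 <= K by rewrite mulr_ge0// invr_ge0 powR_ge0.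
have [[Lu LGu _] _] := Hu; have [[Lv LGv _] _] := Hv; have [[Lpsi LGpsi _] _] := Hpsi.
have /Lebesgue_space2P[mu _ _] := Lu; have /Lebesgue_space2P[mv _ _] := Lv.
have /Lebesgue_space2P[mpsi psii psi0] := Lpsi.
have iLu := dotp_integrable LGu LGpsi; have iLv := dotp_integrable LGv LGpsi.
have fpsi : (\int[leb]_x (psi x ^+ 2)%:E <= (fine (\int[leb]_x (psi x ^+ 2)%:E))%:E)%E.
  by rewrite fineK// ge0_fin_numE// integral_ge0// => x _; rewrite lee_fin sqr_ge0.
have bu : {ae leb, forall x, Omega x -> `|singular_coef gamma f n u x| <= K}.
  apply: filterS2 fg u0 => x fg u0 Ox.
  have /andP[f0 _] := fg Ox.
  by have /andP[? ?] := singular_coef_bound gamma0 n0 f0 (u0 Ox); rewrite ger0_norm.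
have bv : {ae leb, forall x, Omega x -> `|singular_coef gamma g n v x| <= K}.
  apply: filterS2 fg v0 => x fg v0 Ox.
  have /andP[f0 /(le_trans f0) g0] := fg Ox.
  by have /andP[? ?] := singular_coef_bound gamma0 n0 g0 (v0 Ox); rewrite ger0_norm.
have mau := measurable_singular_coef gamma n mf mu.
have mav := measurable_singular_coef gamma n mg mv.
have [iRu _] := mul_bounded_L2 oOmega bOmega mpsi mau psi0 bu K0 ltr01 fpsi.
have [iRv _] := mul_bounded_L2 oOmega bOmega mpsi mav psi0 bv K0 ltr01 fpsi.
set Ru := (\int[leb]_x (psi x * singular_coef gamma f n u x)%:E)%E.
set Rv := (\int[leb]_x (psi x * singular_coef gamma g n v x)%:E)%E.
have := regularized_weak_formT WFu Hpsi.
have := regularized_weak_formT WFv Hpsi.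
rewrite -/Ru -/Rv.
set Lu' := (\int[leb]_x (dotp (Gu x) (Gpsi x))%:E)%E.
set Lv' := (\int[leb]_x (dotp (Gv x) (Gpsi x))%:E)%E.
set Iu := nonlocal_form s u psi; set Iv := nonlocal_form s v psi.
move=> Ev Eu.
have IvIu : ((@frac_const R N s / 2)%:E * Iv <= (@frac_const R N s / 2)%:E * Iu)%E.
  apply: lee_wpmul2l; first by rewrite lee_fin divr_ge0// frac_const_ge0.
  apply: integral_mono => z _; rewrite lee_fin.
  rewrite ler_wpM2r ?invr_ge0 ?powR_ge0// -subr_ge0 -mulrBl.
  have := softplus_mul_ge0 (u z.1 - v z.1) (u z.2 - v z.2) e0.
  by rewrite (_ : u z.1 - u z.2 - _ = u z.1 - v z.1 - (u z.2 - v z.2)); last ring.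
have fLu : Lu' \is a fin_num := integrable_fin_num measurableT iLu.
have fLv : Lv' \is a fin_num := integrable_fin_num measurableT iLv.
have fRu : Ru \is a fin_num := integrable_fin_num measurableT iRu.
have fRv : Rv \is a fin_num := integrable_fin_num measurableT iRv.
have LR := leeB_of_addE fLu fLv fRu fRv Eu Ev IvIu.
apply: (le_trans _ (le_trans LR _)).
  rewrite -integralB_EFin//; apply: integral_mono => x _.
  by rewrite -EFinB lee_fin; apply: dotp_scale_ge; rewrite logistic_ge0 logistic_le1.
have Ke0 : 0 <= K * e by rewrite mulr_ge0// ltW.
have [iC CE] := integral_cst_indic Ke0.
rewrite /Ru /Rv -integralB_EFin// mulrA -CE.
under eq_integral do rewrite -EFinB.
apply: ae_le_integral => //.
- have := integrableB measurableT iRu iRv.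
  by apply: eq_integrable => // x _; rewrite /= EFinB.
- apply: filterS3 fg u0 v0 => x fg u0 v0.
  have [Ox|nOx] := pselect (Omega x); last first.
    by rewrite psi0// !mul0r subrr mulr_ge0// indicE.
  rewrite indicE mem_set//= mulr1 -mulrBr.
  by apply: singular_coef_softplus_le; [| | |exact: fg|exact: u0|exact: v0].
Qed.

End comparison.

(** * The comparison principle *)

Section comparison_principle.
Context {R : realType} {N : nat} (Omega : set 'rV[R]_N).
Hypotheses (oOmega : open Omega) (bOmega : bounded_set Omega).
Local Notation leb := (@lebesgue_rV R N).
Local Notation vol := (fine (leb Omega)).
Implicit Types (f g u v h psi : 'rV[R]_N -> R) (G H : 'rV[R]_N -> 'rV[R]_N).

Lemma partial_coord (i : 'I_N) (x : 'rV[R]_N) :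
  partial i (fun y : 'rV[R]_N => y ord0 i) x = 1.
Proof.
have gE (h : R) : (h *: delta_mx ord0 i + x) ord0 i = h *: 1 + x ord0 i :> R.
  by rewrite !mxE !eqxx.
by have [_] := @is_derive_affine R 'rV[R]_N R (fun y => y ord0 i) id x
  (delta_mx ord0 i) 1 1 gE (is_derive_id _ _).
Qed.

Lemma coord_bounded (i : 'I_N) :
  exists2 M : R, 0 <= M & forall x, Omega x -> `|x ord0 i| <= M.
Proof.
have [M0 [_ /(_ (`|M0| + 1))]] := bOmega.
rewrite (le_lt_trans (ler_norm M0)) ?ltrDl// => /(_ isT) bM.
exists (`|M0| + 1) => [|x Ox]; first by rewrite addr_ge0.
apply: le_trans (bM x Ox).
rewrite [leRHS]/Num.Def.normr /= mx_normrE; apply/bigmax_geP; right => /=.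
by exists (ord0, i).
Qed.

(** Integration by parts against the coordinate function x_i, whose derivative in
    the direction i is 1: a substitute for the Poincare inequality. *)
Lemma H10_integralE u G (i : 'I_N) : H10 Omega u G ->
  [/\ leb.-integrable setT (fun x => (u x)%:E),
      leb.-integrable setT (fun x => (G x ord0 i * x ord0 i)%:E) &
      (\int[leb]_x (u x)%:E + \int[leb]_x (G x ord0 i * x ord0 i)%:E = 0)%E].
Proof.
move=> Hu; have [phi_ au] := H10_approximates Hu; have [[Lu LG _] _] := Hu.
have [M _ bM] := coord_bounded i.
have dE : partial i (fun y : 'rV[R]_N => y ord0 i) = cst 1.
  by apply/funext => x; exact: partial_coord.
have cd : continuous (partial i (fun y : 'rV[R]_N => y ord0 i)).
  by rewrite dE; exact: cst_continuous.
have bd : exists C : R, forall x, Omega x ->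
    `|partial i (fun y : 'rV[R]_N => y ord0 i) x| <= C.
  by exists 1 => x _; rewrite dE normr1.
have := @approximates_by_parts R N Omega oOmega bOmega phi_ u G
  (fun y => y ord0 i) i Lu (LG i) au (fun x => differentiable_coord x ord0 i) cd
  (ex_intro _ M bM) bd.
rewrite dE (_ : (fun x => (u x * _)%:E) = (fun x => (u x)%:E))//.
by apply/funext => x; rewrite mulr1.
Qed.

(** The integral of psi = softplus (u - v) is minus that of x_i times the i-th
    component of its gradient.  The latter is of order sqrt e by the energy
    estimate, and psi differs from the positive part of u - v by at most e.  Hence
    the integral of the positive part of u - v vanishes. *)
Lemma regularized_comparison (s gamma : R) f g n u v (i : 'I_N) :
  0 <= gamma -> (0 < n)%N ->
  measurable_fun setT f -> measurable_fun setT g ->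
  {ae leb, forall x, Omega x -> 0 <= f x <= g x} ->
  regularized_solution Omega s gamma f n u ->
  regularized_solution Omega s gamma g n v ->
  {ae leb, forall x, Omega x -> u x <= v x}.
Proof.
move=> gamma0 n0 mf mg fg [u0 [Gu Hu WFu]] [v0 [Gv Hv WFv]].
have [M M0 bM] := coord_bounded i.
pose K := n%:R * (n%:R^-1 `^ gamma)^-1 : R.
have K0 : 0 <= K by rewrite mulr_ge0// invr_ge0 powR_ge0.
have vol0 : 0 <= vol by rewrite fine_ge0.
have [[Lu _ _] _] := Hu; have [[Lv _ _] _] := Hv.
have /Lebesgue_space2P[mu _ uO] := Lu; have /Lebesgue_space2P[mv _ vO] := Lv.
pose wp x := Num.max 0 (u x - v x).
have wp0 x : 0 <= wp x by rewrite le_max lexx.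
have mwp : measurable_fun setT wp.
  by apply: measurable_maxr; [exact: measurable_cst|exact: measurable_funB].
pose C := M * vol * (1 + K) + vol.
have C0 : 0 <= C by rewrite addr_ge0// mulr_ge0// ?mulr_ge0// addr_ge0.
have small (t : R) : 0 < t <= 1 -> (\int[leb]_x (wp x)%:E <= (t * C)%:E)%E.
  (* With e = t ^ 2, the energy is of order t ^ 2, and Young's inequality with
     parameter t bounds the integral of psi by a multiple of t. *)
  move=> /andP[t0 t1]; pose e := t ^+ 2; have e0 : 0 < e by rewrite exprn_gt0.
  have Hpsi := H10_softplus oOmega bOmega e0 (H10B oOmega bOmega Hu Hv).
  set psi := _ \o _ in Hpsi; set Gpsi := (fun x => _) in Hpsi.
  have [[Lpsi LGpsi _] _] := Hpsi.
  have /Lebesgue_space2P[mG _ GO] := LGpsi i.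
  have [ipsi iG psiE] := H10_integralE i Hpsi.
  have en : (\int[leb]_x (Gpsi x ord0 i ^+ 2)%:E <= (K * (e * vol))%:E)%E.
    apply: le_trans (energy_estimate oOmega bOmega i gamma0 n0 e0 mf mg fg u0 v0
      Hu Hv WFu WFv).
    by apply: ge0_integral_mono => x _; rewrite lee_fin ?sqr_ge0// /Gpsi !mxE.
  have [_ Gx] := mul_bounded_L2 oOmega bOmega mG (@measurable_coord _ R N i) GO
    (aeW leb bM) M0 t0 en.
  have psi_le : (\int[leb]_x (psi x)%:E <= (t * (M * vol * (1 + K)))%:E)%E.
    rewrite (_ : t * _ = M * (t * vol + t^-1 * (K * (e * vol)))); last first.
      by rewrite /e; field; rewrite gt_eqF.
    apply: le_trans Gx.
    apply: (le_trans _ (le_abse_integral leb measurableT (measurable_int _ iG))).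
    have fpsi := integrable_fin_num measurableT ipsi.
    have fG := integrable_fin_num measurableT iG.
    move: psiE; rewrite -(fineK fpsi) -(fineK fG) -EFinD => -[/eqP].
    by rewrite addr_eq0 => /eqP ->; rewrite lee_fin -normrN ler_norm.
  have [iC CE] := integral_cst_indic oOmega bOmega (ltW e0).
  apply: (@le_trans _ _ (\int[leb]_x ((psi x)%:E + (e * \1_Omega x)%:E))%E).
    apply: ge0_integral_mono => x _; first by rewrite lee_fin.
    rewrite -EFinD lee_fin; have [Ox|nOx] := pselect (Omega x).
      rewrite indicE mem_set//= mulr1 -lerBlDr.
      by have /andP[] := softplus_near (u x - v x) e0.
    by rewrite /wp uO// vO// subrr maxxx Lpsi.2// add0r mulr_ge0 ?(ltW e0)// indicE.
  rewrite integralD// CE mulrDr EFinD leeD// lee_fin.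
  by rewrite ler_wpM2r// /e expr2 ler_piMl// ltW.
have iwp0 : (\int[leb]_x `|(wp x)%:E| = 0)%E.
  under eq_integral do rewrite gee0_abs ?lee_fin//.
  apply/eqP; rewrite eq_le integral_ge0 ?andbT; last by move=> x _; rewrite lee_fin.
  apply/lee_addgt0Pr => e e0; rewrite add0e.
  pose t := Num.min 1 (e / (C + 1)).
  have C10 : 0 < C + 1 by rewrite ltr_wpDl.
  have t0 : 0 < t by rewrite lt_min ltr01 divr_gt0.
  have t1 : t <= 1 by rewrite ge_min lexx.
  apply: (le_trans (small t _)); first by rewrite t0.
  rewrite lee_fin (@le_trans _ _ (e / (C + 1) * C))//.
    by rewrite ler_wpM2r// ge_min lexx orbT.
  by rewrite mulrAC ler_pdivrMr// ler_pM2l// lerDl.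
have /(ae_eq_integral_abs leb measurableT) : measurable_fun setT (EFin \o wp).
  exact/measurable_EFinP.
move=> /(iffLR) /(_ iwp0); apply: filterS => x /(_ Logic.I) /= [wpx] _.
by rewrite -subr_le0 -wpx le_max lexx orbT.
Qed.

End comparison_principle.

Theorem corollary2p1 (R : realType) (N : nat) (hN : (2 <= N)%N)
  (Omega : set 'rV[R]_N) (hOmega : bounded_C11_domain Omega)
  (s : R) (hs : 0 < s < 1) (gamma : R) (hgamma : 0 <= gamma)
  (r : R) (hr : 1 <= r < N%:R / 2) (hrgamma : (r, gamma) <> (1, 0))
  (f g : 'rV[R]_N -> R)
  (hf : Lebesgue_space Omega r f) (hg : Lebesgue_space Omega r g)
  (hf0 : ~ {ae @lebesgue_rV R N, forall x, Omega x -> f x = 0})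
  (hg0 : ~ {ae @lebesgue_rV R N, forall x, Omega x -> g x = 0})
  (hfnneg : {ae @lebesgue_rV R N, forall x, Omega x -> 0 <= f x})
  (hgnneg : {ae @lebesgue_rV R N, forall x, Omega x -> 0 <= g x})
  (u v : 'rV[R]_N -> R)
  (hu : approximation_solution Omega s gamma f u)
  (hv : approximation_solution Omega s gamma g v)
  (hfg : {ae @lebesgue_rV R N, forall x, Omega x -> f x <= g x}) :
  {ae @lebesgue_rV R N, forall x, Omega x -> u x <= v x}.
Proof.
have [_ oOmega _ bOmega _] := hOmega.
have [u_ [solu cvgu]] := hu; have [v_ [solv cvgv]] := hv.
have mf : measurable_fun setT f by have := sub_Lfun_mfun hf.1; rewrite inE.
have mg : measurable_fun setT g by have := sub_Lfun_mfun hg.1; rewrite inE.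
have fg : {ae @lebesgue_rV R N, forall x, Omega x -> 0 <= f x <= g x}.
  by apply: filterS2 hfnneg hfg => x f0 fg Ox; rewrite f0// fg.
have uv n : {ae @lebesgue_rV R N, forall x, Omega x -> u_ n.+1 x <= v_ n.+1 x}.
  exact: (regularized_comparison oOmega bOmega (Ordinal (ltnW hN)) hgamma
    (ltn0Sn n) mf mg fg (solu _ (ltn0Sn n)) (solv _ (ltn0Sn n))).
apply: filterS3 cvgu cvgv (ae_foralln uv) => x ux vx uvx Ox.
apply: (ler_cvg_to ux vx).
(* The approximating problems are set for n > 0 only. *)
by exists 1%N => // -[//|n] _; exact: uvx.
Qed.
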